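(* Let $K$ be a field (of arbitrary characteristic), $n$ a positive integer, and $R=K[x_1,\ldots,x_n]$ with the standard grading. (a) Let $d\ge 1$ with $n-d\ge d$. The Hilbert series of $R/I^{\rm Sp}_{(n-d,d)}$ is $$H(R/I^{\rm Sp}_{(n-d,d)},t)=\frac{1+h_1t+h_2t^2+\cdots+h_dt^d}{(1-t)^d},$$ where $$h_i=\begin{cases}\binom{n-d+i-1}{i} & \text{if } 1\le i\le d-1,\\ \binom{n-1}{d-2} & \text{if } i=d.\end{cases}$$ (b) Let $d\ge 1$ and $n=2d+1$. The Hilbert series of $R/I^{\rm Sp}_{(d,d,1)}$ is $$H(R/I^{\rm Sp}_{(d,d,1)},t)=\frac{1+h_1t+h_2t^2+\cdots+h_{d+1}t^{d+1}}{(1-t)^{d+1}},$$ where $h_i=\binom{d+i-1}{i}$ for all $1\le i\le d+1$.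
   Context: A partition of $n$ is a sequence $\lambda=(\lambda_1,\ldots,\lambda_l)$ of integers with $\lambda_1\ge\cdots\ge\lambda_l\ge 1$ and $\sum_i\lambda_i=n$. A Young tableau of shape $\lambda$ is a bijective filling of the boxes of the Young diagram of $\lambda$ (row $i$ has $\lambda_i$ boxes, left-justified) with the letters $1,\ldots,n$; $\operatorname{Tab}(\lambda)$ denotes the set of all such tableaux (no monotonicity is required). For $T\in\operatorname{Tab}(\lambda)$, if the $j$-th column of $T$ consists of $j_1,j_2,\ldots,j_m$ from top to bottom, put $f_T(j):=\prod_{1\le s<t\le m}(x_{j_s}-x_{j_t})$ (equal to $1$ if the column has one box). The Specht polynomial of $T$ is $f_T:=\prod_{j=1}^{\lambda_1}f_T(j)\in R$. The Specht ideal of $\lambda$ is $I^{\rm Sp}_\lambda:=(f_T\mid T\in\operatorname{Tab}(\lambda))\subset R$. The Hilbert series of a finitely generated graded module $M$ is $H(M,t)=\sum_i\dim_K[M]_i\,t^i$. Convention: $\binom{a}{b}=0$ for $b<0$ (relevant only when $d=1$ in (a)). *)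

(* Defs.v *)
From mathcomp Require Import all_boot all_algebra.
From mathcomp Require Import mpoly.
From Stdlib Require Import Classical ClassicalEpsilon.

Set Implicit Arguments.
Unset Strict Implicit.
Unset Printing Implicit Defensive.

Import GRing.Theory.
Local Open Scope ring_scope.

(* Rows and columns are numbered from 0. *)
Definition box (la : seq nat) : finType :=
  {i : 'I_(size la) & 'I_(nth 0%N la i)}.

Definition brow (la : seq nat) (b : box la) : nat := tag b.
Definition bcol (la : seq nat) (b : box la) : nat := tagged b.

(* A tableau with entries in 'I_n rather than {1, ..., n}. *)
Definition tableau (n : nat) (la : seq nat) (T : box la -> 'I_n) : Prop :=
  bijective T.

Definition specht_col (K : fieldType) (n : nat) (la : seq nat)
    (T : box la -> 'I_n) (j : nat) : {mpoly K[n]} :=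
  \prod_(p : box la * box la |
           [&& bcol p.1 == j, bcol p.2 == j & (brow p.1 < brow p.2)%N])
     ('X_(T p.1) - 'X_(T p.2)).

Definition specht_poly (K : fieldType) (n : nat) (la : seq nat)
    (T : box la -> 'I_n) : {mpoly K[n]} :=
  \prod_(j < head 0%N la) specht_col K T j.

Definition ideal_gen (R : comNzRingType) (S : R -> Prop) (p : R) : Prop :=
  exists (m : nat) (c g : 'I_m -> R),
    (forall i, S (g i)) /\ p = \sum_(i < m) c i * g i.

Definition specht_ideal (K : fieldType) (n : nat) (la : seq nat) :
    {mpoly K[n]} -> Prop :=
  ideal_gen (fun f => exists T : box la -> 'I_n,
                        tableau T /\ f = specht_poly K T).
Arguments specht_ideal : clear implicits.

Section HilbertFunction.
Variables (K : fieldType) (n : nat).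
Implicit Types (I : {mpoly K[n]} -> Prop) (k m : nat).

Definition free_mod I m (b : 'I_m -> {mpoly K[n]}) : Prop :=
  forall c : 'I_m -> K, I (\sum_(i < m) c i *: b i) -> forall i, c i = 0.

(* The residue classes of b form a K-basis of [R/I]_k, the image in R/I of the
   space of forms of degree k. *)
Definition quot_basis I k m (b : 'I_m -> {mpoly K[n]}) : Prop :=
  [/\ forall i, b i \is k.-homog,
      free_mod I b
    & forall p, p \is k.-homog ->
        exists c : 'I_m -> K, I (p - \sum_(i < m) c i *: b i)].

Definition quot_dim I k m : Prop :=
  exists b : 'I_m -> {mpoly K[n]}, quot_basis I k b.

(* dim_K [R/I]_k; quot_dim_hilbert and hilbert_fun_eq below show that for an
   ideal I this is the unique m such that quot_dim I k m. *)
Definition hilbert_fun I k : nat := epsilon (inhabits 0%N) (quot_dim I k).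

Definition subspace I : Prop :=
  I 0 /\ forall (c : K) p q, I p -> I q -> I (c *: p + q).

Lemma subspace_sum I m (c : 'I_m -> K) (f : 'I_m -> {mpoly K[n]}) :
  subspace I -> (forall i, I (f i)) -> I (\sum_(i < m) c i *: f i).
Proof.
case=> I0 IZD If; elim/big_rec: _ => // i p _ Ip; exact: IZD.
Qed.

Lemma free_mod_le I k m (b : 'I_m -> {mpoly K[n]}) :
  subspace I -> (forall i, b i \is k.-homog) -> free_mod I b ->
  (m <= #|{: 'X_{1..n < k.+1}}|)%N.
Proof.
move=> [I0 _] hb fb; set N := #|_|.
pose A : 'M[K]_(m, N) := \matrix_(i, j) (b i)@_(enum_val j : 'X_{1..n < k.+1}).
suff: row_free A by rewrite /row_free => /eqP <-; exact: rank_leq_col.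
rewrite -kermx_eq0; apply/rowV0P => u /sub_kermxP uA.
suff s0 : \sum_i u 0 i *: b i = 0.
  by apply/rowP => i; rewrite mxE; apply: (fb (fun i => u 0 i)); rewrite s0.
apply/mpolyP => mu; rewrite mcoeff0.
have [kmu|kmu] := eqVneq (mdeg mu) k; last first.
  apply: (@dhomog_nemf_coeff _ _ mdeg k) => //.
  by apply: rpred_sum => i _; apply: rpredZ.
have lt_mu : (mdeg mu < k.+1)%N by rewrite kmu.
have := congr1 (fun M : 'rV_N => M 0 (enum_rank (BMultinom lt_mu))) uA.
rewrite !mxE raddf_sum /= => {2}<-; apply: eq_bigr => i _.
by rewrite mcoeffZ mxE enum_rankK.
Qed.

Lemma quot_dim_ex I k : subspace I -> exists m, quot_dim I k m.
Proof.
move=> sI; set N := #|{: 'X_{1..n < k.+1}}|.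
pose fr m := exists b : 'I_m -> {mpoly K[n]},
  (forall i, b i \is k.-homog) /\ free_mod I b.
have fr_le m : fr m -> (m <= N)%N by case=> b [hb fb]; exact: free_mod_le hb fb.
have [m [[b [hb fb]] nfr]] : exists m, fr m /\ ~ fr m.+1.
  apply: NNPP => H.
  suff /fr_le: fr N.+1 by rewrite ltnn.
  elim: N.+1 => [|m IH]; first by exists (fun=> 0); split=> [[]|c _ []].
  by apply: NNPP => Hm; apply: H; exists m.
exists m, b; split=> // p hp; apply: NNPP => Hp; apply: nfr.
exists (fun i => if unlift ord_max i is Some j then b j else p).
split=> [i|c]; first by case: unliftP.
rewrite big_ord_recr /= unlift_none => Ic.
have {}Ic : I (\sum_(i < m) c (lift ord_max i) *: b i + c ord_max *: p).
  congr (I (_ + _)): Ic; apply: eq_bigr => i _.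
  have -> : widen_ord (leqnSn m) i = lift ord_max i.
    by apply/val_inj; rewrite /= /bump leqNgt ltn_ord.
  by rewrite liftK.
have c0 : c ord_max = 0.
  apply/eqP/negPn/negP => nz; apply: Hp.
  exists (fun i => - (c ord_max)^-1 * c (lift ord_max i)).
  case: sI => I0 /(_ (c ord_max)^-1 _ _ Ic I0); rewrite addr0 scalerDr.
  rewrite scalerA mulVf // scale1r addrC scaler_sumr -sumrN.
  congr (I (_ + _)); apply: eq_bigr => i _.
  by rewrite scalerA mulNr scaleNr opprK.
move: Ic; rewrite c0 scale0r addr0 => Ic i.
by case: (unliftP ord_max i) => [j ->|->] //; apply: (fb (fun j => c (lift ord_max j))).
Qed.

Lemma quot_basis_le I k m m' (b : 'I_m -> {mpoly K[n]})
    (b' : 'I_m' -> {mpoly K[n]}) :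
  subspace I -> quot_basis I k b -> quot_basis I k b' -> (m <= m')%N.
Proof.
move=> sI [hb fb _] [hb' _ gb'].
pose C i := proj1_sig (constructive_indefinite_description _ (gb' _ (hb i))).
have CP i : I (b i - \sum_j C i j *: b' j) by rewrite /C; case: constructive_indefinite_description.
pose A : 'M[K]_(m, m') := \matrix_(i, j) C i j.
suff: row_free A by rewrite /row_free => /eqP <-; exact: rank_leq_col.
rewrite -kermx_eq0; apply/rowV0P => u /sub_kermxP uA.
apply/rowP => i; rewrite mxE; apply: (fb (fun i => u 0 i)).
have := subspace_sum (fun i => u 0 i) sI CP.
congr (I _); apply/eqP; rewrite -subr_eq0 -sumrB; apply/eqP.
under eq_bigr => l _ do rewrite scalerBr addrAC subrr add0r scaler_sumr.
rewrite sumrN exchange_big /= big1 ?oppr0 // => j _.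
have := congr1 (fun M : 'rV_m' => M 0 j) uA; rewrite !mxE => uAj.
under eq_bigr => l _ do rewrite scalerA.
rewrite -scaler_suml (_ : \sum_l _ = 0) ?scale0r //.
by rewrite -[RHS]uAj; apply: eq_bigr => l _; rewrite mxE.
Qed.

Lemma quot_dim_hilbert I k : subspace I -> quot_dim I k (hilbert_fun I k).
Proof. by move=> /(quot_dim_ex k); apply: epsilon_spec. Qed.

Lemma hilbert_fun_eq I k m : subspace I -> quot_dim I k m -> hilbert_fun I k = m.
Proof.
move=> sI [b hb]; have [b' hb'] := quot_dim_hilbert k sI.
by apply/eqP; rewrite eqn_leq (quot_basis_le sI hb hb') (quot_basis_le sI hb' hb).
Qed.

Lemma ideal_gen_subspace (S : {mpoly K[n]} -> Prop) : subspace (ideal_gen S).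
Proof.
split; first by exists 0%N, (fun=> 0), (fun=> 0); split=> [[]|] //; rewrite big_ord0.
move=> a p q [m [c [g [Sg ->]]]] [m' [c' [g' [Sg' ->]]]].
exists (m + m')%N,
  (fun i => match split i with inl j => a *: c j | inr j => c' j end),
  (fun i => match split i with inl j => g j | inr j => g' j end).
split=> [i|]; first by case: (split i).
rewrite big_split_ord scaler_sumr /=; congr (_ + _); apply: eq_bigr => i _.
  by rewrite -[lshift _ _]/(unsplit (inl i)) unsplitK scalerAl.
by rewrite -[rshift _ _]/(unsplit (inr i)) unsplitK.
Qed.

End HilbertFunction.

(* The formal power series sum_i H(i) t^i equals P / Q in Z[[t]], that is,
   (sum_i H(i) t^i) * Q = P; used with Q invertible in Z[[t]]. *)
Definition series_eq_frac (H : nat -> nat) (P Q : {poly int}) : Prop :=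
  forall k, \sum_(j < k.+1) (H j)%:Z * Q`_(k - j) = P`_k.

(* Binomial coefficient with the convention that it is 0 for b < 0. *)
Definition binz (a : nat) (b : int) : nat :=
  if b is Posz k then 'C(a, k) else 0%N.

(* For 1 <= i <= d. *)
Definition h_two_rows (n d i : nat) : nat :=
  if (i < d)%N then 'C(n - d + i - 1, i) else binz (n - 1) (d%:Z - 2).

(* Main.v *)
Require Import Defs.
From HB Require Import structures.
From mathcomp Require Import all_boot all_order all_algebra.
From mathcomp Require Import mpoly.
From Stdlib Require Import ClassicalEpsilon.
From mathcomp Require Import zify ring.

(** Let [c] be the number of columns of the shape and [D = n - c]: thus [c = n - d], [D = d]
    for [(n-d, d)], and [c = d], [D = d + 1] for [(d, d, 1)]. Both shapes satisfy
    [n <= 2c + 1], and both ideals are instances of one ideal [J_c], that of the polynomials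
    vanishing wherever more than [c] of the coordinates coincide ([vanish_equal c]).

    Why the Specht ideal is [J_c]. A Specht polynomial is in [J_c] because two of any [c + 1]
    indices share a column. Conversely, let [p] in [J_c] be homogeneous with leading monomial
    [x^u]. Read [u] from the last index down, and put index [i] on the first of the chains
    built so far whose length is at most [u_i], or on a new one. If this produces at most [c]
    chains, the product of the Vandermonde determinants of the chains has a leading monomial
    dividing [x^u], and [p] can be reduced. If it produced more, [p] would not vanish at some
    point with more than [c] equal coordinates: choose the values of the coordinates one after
    the other, again from the last index down; the leading coefficient of [p], as a polynomial in the
    current coordinate, is nonzero and has degree [u_i], so it excludes at most [u_i] values,
    and the most frequent value that is not excluded is a good choice ([greedy_columns],
    [vanish_equal_colprod]). So [J_c] is spanned by the multiples of all products of
    Vandermonde determinants over [c] columns of any lengths; a three-term relation moves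
    entries from long columns to short ones ([colprod_balance]), and since [n <= 2c + 1] the
    columns that remain are those of the given shape ([colprod_specht]).

    Why the Hilbert series is as claimed. Add a variable [v], and put [y_i = x_i - v]. The
    polynomials in [K[y, v]] that vanish wherever more than [c] of the [y_i] are zero
    ([vanish_zeros c]) are spanned by the monomials with at most [c] zero exponents among
    those of the [y_i], so that counting monomials gives the Hilbert function
    [b_c(k) = sum_(s < n - c) C(n, s) C(k, s)] of the quotient ([vanish_zeros_dim]). Now filter
    [K[y, v] = K[x, v]] by the degree in [v]. The leading coefficients of the elements of
    degree [e] in [v] of this ideal form exactly [J_(c+e)]. They belong to it because
    translating [v] with [x] fixed, and taking the part of order [e] in the translation,
    removes at most [e] of the [y_i] from each monomial ([top_coeff]). They exhaust it because,
    as [n <= 2c + 1], the [c + e] columns of a product generating [J_(c+e)] include [e]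
    singletons [s], or [n - c] of them if this is less, and the product times these [x_s - v]
    vanishes as required ([singletons_vanish_zeros], [span_layer]). Hence
    [sum_e H_(c+e)(k - e) = b_c(k)], where [H_c] is the Hilbert function of the quotient by
    [J_c], and the same equality for [c + 1] leaves
    [H_c(k) = b_c(k) - b_(c+1)(k - 1)] ([hilbert_vanish_equal]). Both sides of the
    resulting identity between numerators satisfy the same Pascal recursion
    ([filtration_numerE]). *)

Set Implicit Arguments.
Unset Strict Implicit.
Unset Printing Implicit Defensive.

Import Order.TTheory GRing.Theory.
Local Open Scope ring_scope.

(** * Vanishing where coordinates coincide, and where they are zero *)

Section Substitution.
Variable K : fieldType.

Definition subst n m (h : 'I_n -> {mpoly K[m]}) : {mpoly K[n]} -> {mpoly K[m]} :=
  mmap (@mpolyC m K) h.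

HB.instance Definition _ n m (h : 'I_n -> {mpoly K[m]}) :=
  GRing.RMorphism.on (subst h).

Lemma substZ n m (h : 'I_n -> {mpoly K[m]}) c p : subst h (c *: p) = c *: subst h p.
Proof. by rewrite /subst mmapZ mul_mpolyC. Qed.

Lemma substX n m (h : 'I_n -> {mpoly K[m]}) i : subst h 'X_i = h i.
Proof. by rewrite /subst mmapX mmap1U. Qed.

Lemma substXm n m (h : 'I_n -> {mpoly K[m]}) u :
  subst h 'X_[u] = \prod_i h i ^+ u i.
Proof. by rewrite /subst mmapX. Qed.

Lemma substE n m (h : 'I_n -> {mpoly K[m]}) p :
  subst h p = \sum_(u <- msupp p) p@_u *: \prod_i h i ^+ u i.
Proof. by rewrite /subst /mmap; apply: eq_bigr => u _; rewrite mul_mpolyC. Qed.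

(** A ring morphism out of a polynomial ring is determined by constants and variables; this
    proves every identity between composite substitutions below. *)
Lemma rmorph_mpoly_ext n (S : comNzRingType) (f g : {rmorphism {mpoly K[n]} -> S}) :
  (forall c, f c%:MP = g c%:MP) -> (forall i, f 'X_i = g 'X_i) -> f =1 g.
Proof.
move=> fgC fgX; elim/mpolyind=> [|c m p _ _ IH]; first by rewrite !rmorph0.
rewrite !rmorphD /= IH -mul_mpolyC !rmorphM /= fgC mpolyXE_id !rmorph_prod /=.
congr (_ * _ + _); apply: eq_bigr => i _.
by rewrite !rmorphXn /= fgX.
Qed.

Lemma subst_comp n m l (g : 'I_m -> {mpoly K[l]}) (h : 'I_n -> {mpoly K[m]}) p :
  subst g (subst h p) = subst (fun i => subst g (h i)) p.
Proof.
apply: (rmorph_mpoly_ext (f := subst g \o subst h)) => [c|i] /=.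
  by rewrite /subst !mmapC.
by rewrite !substX.
Qed.

End Substitution.

Section Arrangement.
Variables (K : fieldType) (n : nat).
Local Notation A := {mpoly K[n.+1]}.
Implicit Types (p q r : {mpoly K[n]}) (P Q : A) (S : {set 'I_n}) (c k : nat).
Local Notation v := ('X_(ord0 : 'I_n.+1) : A).
Local Notation y i := ('X_(lift ord0 i) : A).

(** The inclusion of [K[x]] into [K[y, v]] for [x_i = y_i + v]. The variable [v] has index
    [ord0]. *)
Definition shift : {mpoly K[n]} -> A := subst (fun i => y i + v).

HB.instance Definition _ := GRing.RMorphism.on shift.

(** Restriction to the subspace [y_i = 0] for [i] in [S]: the points where all [x_i]
    with [i] in [S] have the common value [v]. *)
Definition kill_val S (j : 'I_n.+1) : A :=
  if unlift ord0 j is Some i then (if i \in S then 0 else y i) else v.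

Definition kill S : A -> A := subst (kill_val S).

HB.instance Definition _ S := GRing.RMorphism.on (kill S).

Lemma killZ S a P : kill S (a *: P) = a *: kill S P.
Proof. exact: substZ. Qed.

Lemma shiftZ a p : shift (a *: p) = a *: shift p.
Proof. exact: substZ. Qed.

Lemma shiftX i : shift 'X_i = y i + v.
Proof. exact: substX. Qed.

Lemma kill_v S : kill S v = v.
Proof. by rewrite /kill substX /kill_val unlift_none. Qed.

Lemma kill_y S i : kill S (y i) = if i \in S then 0 else y i.
Proof. by rewrite /kill substX /kill_val liftK. Qed.

Definition zeros (m : 'X_{1..n.+1}) : {set 'I_n} := [set i | m (lift ord0 i) == 0%N].

Lemma kill_Xm S (m : 'X_{1..n.+1}) :
  kill S 'X_[m] = if S \subset zeros m then 'X_[m] else 0.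
Proof.
rewrite /kill substXm; case: ifP => [/subsetP sS|/subsetPn[i iS]].
  rewrite [RHS]mpolyXE_id; apply: eq_bigr => j _.
  rewrite /kill_val; case: unliftP => [i ->|-> //].
  by case: ifP => // /sS; rewrite inE => /eqP->; rewrite !expr0.
rewrite inE => mi; rewrite (bigD1 (lift ord0 i)) //= {1}/kill_val liftK iS.
by rewrite expr0n (negbTE mi) mul0r.
Qed.

Definition vanish_zeros c P : Prop := forall S, (c < #|S|)%N -> kill S P = 0.

(** On the subspace where the coordinates in [S] coincide, take [v] to be their common
    value: then [y_i = 0] on [S]. *)
Definition vanish_equal c p : Prop := vanish_zeros c (shift p).

Lemma vanish_zeros_subspace c : subspace (vanish_zeros c).
Proof.
split=> [S _|a P Q sP sQ S cS]; first by rewrite rmorph0.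
by rewrite rmorphD /= killZ sP // sQ // scaler0 addr0.
Qed.

Lemma vanish_equal_subspace c : subspace (vanish_equal c).
Proof.
have [s0 sD] := vanish_zeros_subspace c.
split=> [|a p q ep eq]; first by rewrite /vanish_equal rmorph0.
by rewrite /vanish_equal rmorphD /= shiftZ; apply: sD.
Qed.

Lemma vanish_zerosM c P Q : vanish_zeros c Q -> vanish_zeros c (P * Q).
Proof. by move=> sQ S cS; rewrite rmorphM /= sQ // mulr0. Qed.

Lemma vanish_equalM c p q : vanish_equal c q -> vanish_equal c (p * q).
Proof. by move=> eq; rewrite /vanish_equal rmorphM; apply: vanish_zerosM. Qed.

(** Killing the variables in [zeros m] keeps the monomial [m] and creates no new
    monomial, so the condition is one on each monomial separately. *)
Lemma vanish_zeros_coeff c P m : vanish_zeros c P -> (c < #|zeros m|)%N -> P@_m = 0.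
Proof.
move=> sP /sP /(congr1 (mcoeff m)); rewrite mcoeff0 => <-.
rewrite {1 2}[P]mpolyE rmorph_sum /= !raddf_sum /=; apply: eq_bigr => u _.
rewrite killZ kill_Xm !mcoeffZ; case: ifP => // zu.
by rewrite mcoeff0 mcoeffX; case: eqP => // um; rewrite um subxx in zu.
Qed.

Lemma vanish_zerosX c m : (#|zeros m| <= c)%N -> vanish_zeros c 'X_[m].
Proof.
move=> zc S cS; rewrite kill_Xm ifN //.
by apply: contraL (leq_ltn_trans zc cS) => /subset_leq_card; rewrite -leqNgt.
Qed.

(** The generic point of the subspace attached to the fibre of [g] over [k] specializes
    to the point with coordinates [X_(g i)], so [p] vanishes there as well. *)
Lemma vanish_equal_subst c m (g : 'I_n -> 'I_m) (k : 'I_m) p :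
  vanish_equal c p -> (c < #|[set i | g i == k]|)%N -> subst (fun i => 'X_(g i)) p = 0.
Proof.
set S := [set i | g i == k] => ep /ep.
pose h (j : 'I_n.+1) : {mpoly K[m]} :=
  if unlift ord0 j is Some i then 'X_(g i) - 'X_k else 'X_k.
move/(congr1 (subst h)); rewrite rmorph0 /shift /kill !subst_comp => <-.
apply: (rmorph_mpoly_ext (f := subst (fun i => 'X_(g i)))
  (g := subst (fun i => subst (fun j => subst h (kill_val S j)) (y i + v)))) => [a|i] /=.
  by rewrite /subst !mmapC.
rewrite !substX !rmorphD /= !substX /kill_val liftK unlift_none.
rewrite [X in _ + X]substX {2}/h unlift_none.
case: ifP => [|_]; last by rewrite substX /h liftK subrK.
by rewrite inE => /eqP ->; rewrite rmorph0 add0r.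
Qed.

Lemma kill_shift_sub S a b :
  a \in S -> b \in S -> kill S (shift ('X_a - 'X_b)) = 0.
Proof.
move=> aS bS; rewrite !rmorphB /= !shiftX !rmorphD /= !kill_y aS bS.
by rewrite add0r subrr.
Qed.

End Arrangement.

(** * Leading monomials and chains of indices *)

Section Columns.
Variables (K : fieldType) (n : nat).

(** The product of the Vandermonde determinants of the columns, [kap i] being the column of
    index [i]. The columns have no prescribed lengths: this is a Specht polynomial, up to sign, for
    the shape given by the sizes of the fibres of [kap]. *)
Definition colprod (C : eqType) (kap : 'I_n -> C) : {mpoly K[n]} :=
  \prod_(p : 'I_n * 'I_n | (p.1 < p.2)%N && (kap p.1 == kap p.2))
     ('X_(p.1) - 'X_(p.2)).

Lemma pigeonhole (T C : finType) (f : T -> C) (S : {set T}) :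
  (#|C| < #|S|)%N -> exists a b, [/\ a \in S, b \in S, a != b & f a = f b].
Proof.
move=> CS; case: (boolP [exists a, [exists b, [&& a \in S, b \in S, a != b & f a == f b]]]).
  by case/existsP=> a /existsP[b /and4P[aS bS ab /eqP fab]]; exists a, b.
move/existsPn=> H; suff /card_in_imset fS : {in S &, injective f}.
  by move: CS; rewrite -fS ltnNge max_card.
move=> a b aS bS /eqP fab; apply/eqP; apply: contraT => ab.
by have /existsPn/(_ b) := H a; rewrite aS bS ab fab.
Qed.

Lemma kill_colprod (C : eqType) (kap : 'I_n -> C) (S : {set 'I_n}) a b :
  a \in S -> b \in S -> a != b -> kap a = kap b ->
  kill S (shift (colprod kap)) = 0.
Proof.
move=> aS bS ab kab.
wlog lt_ab : a b aS bS ab kab / (a < b)%N => [IH|].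
  case: (ltngtP a b) => [|ba|/val_inj/eqP]; [exact: IH | | by rewrite (negbTE ab)].
  by apply: (IH b a) => //; rewrite eq_sym.
rewrite /colprod (bigD1 (a, b)) /=; last by rewrite lt_ab kab eqxx.
by rewrite rmorphM rmorphM [X in X * _]kill_shift_sub // mul0r.
Qed.

Lemma colprod_vanish_equal c (kap : 'I_n -> 'I_c) : vanish_equal c (colprod kap).
Proof.
move=> S; rewrite -{1}[c]card_ord => /(pigeonhole kap)[a [b [aS bS ab kab]]].
exact: kill_colprod kab.
Qed.

Lemma mlead_sub (a b : 'I_n) : (a < b)%N ->
  mlead ('X_a - 'X_b : {mpoly K[n]}) = U_(a)%MM.
Proof.
move=> ab; rewrite mleadDl ?mleadN !mleadXm //.
apply/ltmcP; first by rewrite !mdeg1.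
exists a => [j ja|]; rewrite !mnm1E.
  by rewrite -!val_eqE /= !gtn_eqF // (ltn_trans ja).
by rewrite eqxx -val_eqE /= gtn_eqF.
Qed.

Lemma sub_neq0 (a b : 'I_n) : (a < b)%N -> ('X_a - 'X_b : {mpoly K[n]}) != 0.
Proof.
move=> ab; apply/eqP => E; move: (mlead_sub ab).
by rewrite E mlead0 => /eqP; rewrite eq_sym mnm1_eq0.
Qed.

Lemma colprod_neq0 (C : eqType) (kap : 'I_n -> C) : colprod kap != 0.
Proof. by apply/prodf_neq0 => -[a b] /= /andP[ab _]; apply: sub_neq0. Qed.

(** Each factor [X_a - X_b] with [a < b] has leading monomial [X_a], so index [i]
    contributes once for every later index in its column. *)
Lemma mlead_colprod (C : eqType) (kap : 'I_n -> C) i :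
  mlead (colprod kap) i = #|[set j : 'I_n | (i < j)%N && (kap j == kap i)]|.
Proof.
rewrite /colprod mlead_prod; last first.
  by move=> -[a b] _ /= /andP[ab _]; apply: sub_neq0.
rewrite mnm_sumE (eq_bigr (fun p : 'I_n * 'I_n => p.1 == i : nat)); last first.
  by move=> -[a b] /= /andP[ab _]; rewrite mlead_sub // mnm1E.
rewrite -big_mkcondr sum1dep_card -[RHS](card_imset _ (f := fun j => (i, j))); last first.
  by move=> j j' [].
apply: eq_card => -[a b]; rewrite !inE /=; apply/idP/imsetP => [|[j]].
  by case/andP=> /andP[ab kab] /eqP <-; exists b; rewrite // inE ab eq_sym.
by rewrite inE => /andP[ij kij] [-> ->]; rewrite ij eq_sym kij eqxx.
Qed.

Lemma colprod_homog (C : eqType) (kap : 'I_n -> C) :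
  colprod kap \is (mdeg (mlead (colprod kap))).-homog.
Proof.
suff [d hd] : exists d, colprod kap \is d.-homog.
  by move/dhomogP: (hd) => H; rewrite (H _ (mlead_supp (colprod_neq0 kap))).
exists (\sum_(p : 'I_n * 'I_n | (p.1 < p.2)%N && (kap p.1 == kap p.2)) 1)%N.
apply: (big_rec2 (fun (d : nat) (q : {mpoly K[n]}) => q \is d.-homog)).
  exact: dhomog1.
move=> [a b] d q _ hq; apply: dhomogM => //.
by rewrite rpredB ?dhomogX /= ?mdeg1.
Qed.

End Columns.

Lemma big_geq_ord (n : nat) R (idx : R) (op : Monoid.com_law idx) (i0 : 'I_n)
    (F : 'I_n -> R) :
  \big[op/idx]_(i < n | (i0 <= i)%N) F i =
  op (F i0) (\big[op/idx]_(i < n | (i0 < i)%N) F i).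
Proof.
rewrite (bigD1 i0) //=; congr (op _ _); apply: eq_bigl => i.
by rewrite ltn_neqAle -val_eqE andbC eq_sym.
Qed.

Section Greedy.
Variables (K : fieldType) (n N c k : nat) (p : {mpoly K[n]}).
Hypotheses (p_neq0 : p != 0) (p_homog : p \is k.-homog).
Hypothesis N_big : forall i, (mlead p i < N)%N.

Local Notation u := (mlead p).
Implicit Types (s : nat) (kap : 'I_n -> nat) (gam : 'I_n -> 'I_N).

Definition prefix_eq s (m : 'X_{1..n}) := [forall j : 'I_n, (j < s)%N ==> (m j == u j)].

(** The coefficient in [p] of the product of the [X_j ^ (u j)] with [j < s], evaluated at
    the point whose coordinates of index at least [s] have been chosen to be the variables
    [X_(gam i)]. The target has [N] variables so that [N] distinct values are available. *)
Definition restr_lead s gam : {mpoly K[N]} :=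
  \sum_(m <- msupp p | prefix_eq s m)
    p@_m *: \prod_(i < n | (s <= i)%N) 'X_(gam i) ^+ m i.

Definition load s gam (a : 'I_N) : nat := \sum_(i < n | (s <= i)%N) (gam i == a).

Definition height s kap (a : nat) : nat := \sum_(i < n | (s <= i)%N) (kap i == a).

Definition ahead s kap (a : nat) : nat := \sum_(i < n | (s <= i)%N) (a <= kap i).

Lemma prefix_eqS (i0 : 'I_n) m :
  prefix_eq i0.+1 m = prefix_eq i0 m && (m i0 == u i0).
Proof.
apply/forallP/andP => [H|[/forallP H1 /eqP H2] j]; last first.
  apply/implyP; rewrite ltnS leq_eqVlt => /orP[/eqP/val_inj -> |ji].
    by rewrite H2.
  by have := H1 j; rewrite ji.
split; last by have := H i0; rewrite leqnn.
apply/forallP=> j; apply/implyP=> ji; have := H j.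
by rewrite ltnS ltnW.
Qed.

(** As [p] is homogeneous, its leading monomial is the lexicographic maximum of its
    support. *)
Lemma prefix_eq_le (i0 : 'I_n) m :
  m \in msupp p -> prefix_eq i0 m -> (m i0 <= u i0)%N.
Proof.
move=> mp /forallP H; rewrite leqNgt; apply/negP => lt.
have /dhomogP hp := p_homog.
have : (u < m)%O.
  apply/ltmcP; first by rewrite !hp // mlead_supp.
  by exists i0 => // j ji; have := H j; rewrite ji => /eqP.
by rewrite ltNge msupp_le_mlead.
Qed.

Lemma aheadS s kap a : ahead s kap a = (height s kap a + ahead s kap a.+1)%N.
Proof.
rewrite /ahead /height -big_split /=; apply: eq_bigr => i _.
by rewrite leq_eqVlt eq_sym; case: ltngtP.
Qed.

(** State after the indices [>= s] have been treated: [kap] places them on chains, and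
    [gam] gives them values. The number of indices on chains numbered at least [a] is the number of
    boxes beyond the first [a] columns of the diagram of the chains; the last clause says that
    the diagram of the values dominates it. *)
Definition greedy_inv s kap gam : Prop :=
  [/\ restr_lead s gam != 0,
      forall i : 'I_n, (s <= i)%N ->
        (\sum_(j < n | (i < j)%N) (kap j == kap i) <= u i)%N
    & forall a, (ahead s kap a <= \sum_(b < N) (load s gam b - a))%N].

(** The chain of [i0] is the first one of height at most [d = u i0], and its value is the
    most frequent one, [b1], for which the leading coefficient stays nonzero. Dominance could
    only fail at some [a <= a0] with [mu b1 < a]. Then the chain [a - 1] has more than [d]
    elements while at most [d] values are used [a] times or more, since these are among the
    [d] excluded ones; so dominance at [a - 1] makes dominance at [a] strict beforehand. *)
Lemma greedy_step (i0 : 'I_n) kap gam :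
  greedy_inv i0.+1 kap gam -> exists kap' gam', greedy_inv i0 kap' gam'.
Proof.
move=> [nz hkap dom]; set d := u i0.
(* [p] as a polynomial in the coordinate [i0], the later ones having been chosen. *)
pose G : {poly {mpoly K[N]}} := \sum_(m <- msupp p | prefix_eq i0 m)
  (p@_m *: \prod_(i < n | (i0 < i)%N) 'X_(gam i) ^+ m i)%:P * 'X^(m i0).
have szG : (size G <= d.+1)%N.
  apply: (leq_trans (size_sum _ _ _)); apply/bigmax_leqP_seq => m mp Hm.
  apply: leq_trans (size_polyMleq _ _) _; rewrite size_polyXn size_polyC.
  have := prefix_eq_le mp Hm; rewrite -/d; case: (_ == 0) => /=; lia.
have nzG : G != 0.
  suff E : G`_d = restr_lead i0.+1 gam by apply: contraNneq nz => G0; rewrite -E G0 coef0.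
  rewrite coef_sum /restr_lead.
  rewrite (bigID (fun m : 'X_{1..n} => m i0 == d)) /= [X in _ + X]big1 ?addr0.
    rewrite [RHS](eq_bigl _ _ (prefix_eqS i0)); apply: eq_bigr => m /andP[_ /eqP ->].
    by rewrite coefCM coefXn eqxx mulr1.
  by move=> m /andP[_ /negbTE md]; rewrite coefCM coefXn eq_sym md mulr0.
pose roots := [set b : 'I_N | root G 'X_b].
have card_roots : (#|roots| <= d)%N.
  rewrite -ltnS; apply: leq_trans szG.
  rewrite cardE -(size_map (fun b : 'I_N => 'X_b : {mpoly K[N]})).
  apply: max_poly_roots => //; first by apply/allP => x /mapP[b]; rewrite mem_enum inE => rb ->.
  rewrite map_inj_uniq ?enum_uniq //; move=> a b /(congr1 (@mlead N K)).
  by rewrite /= !mleadXm => /eqP; rewrite eq_mnm1 => /eqP.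
have [b0 b0_nr] : exists b, b \notin roots.
  apply/existsP; apply: contraLR (leq_ltn_trans card_roots (N_big i0)).
  rewrite negb_exists -leqNgt -[leqLHS]card_ord => /forallP H.
  by apply/subset_leq_card/subsetP => b _; have := H b; rewrite negbK.
pose mu := load i0.+1 gam.
case: (@arg_maxnP _ b0 (fun b => b \notin roots) mu b0_nr) => b1 b1_nr b1_max.
have ex_short : exists a, (height i0.+1 kap a <= d)%N.
  exists (\max_i kap i).+1; rewrite /height big1 // => i _.
  by apply/eqP; rewrite eqb0 neq_ltn ltnS leq_bigmax.
pose a0 := ex_minn ex_short.
have [a0_short a0_min] : (height i0.+1 kap a0 <= d)%N /\
    forall a, (a < a0)%N -> (d < height i0.+1 kap a)%N.
  rewrite /a0; case: ex_minnP => a ha amin; split=> // a' aa'.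
  by rewrite ltnNge; apply: contraL aa' => /amin; rewrite -leqNgt.
pose kap' i := if i == i0 then a0 else kap i.
pose gam' i := if i == i0 then b1 else gam i.
have kapE (i : 'I_n) : (i0 < i)%N -> kap' i = kap i.
  by move=> ii; rewrite /kap' -val_eqE gtn_eqF.
have gamE (i : 'I_n) : (i0 < i)%N -> gam' i = gam i.
  by move=> ii; rewrite /gam' -val_eqE gtn_eqF.
have kap0 : kap' i0 = a0 by rewrite /kap' eqxx.
have gam0 : gam' i0 = b1 by rewrite /gam' eqxx.
exists kap', gam'; split.
- suff -> : restr_lead i0 gam' = G.['X_b1] by move: b1_nr; rewrite inE.
  rewrite /restr_lead /G horner_sum; apply: eq_bigr => m _.
  rewrite hornerCM hornerXn big_geq_ord gam0 [RHS]mulrC -scalerAr.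
  by congr (_ *: (_ * _)); apply: eq_bigr => i /gamE ->.
- move=> i; rewrite leq_eqVlt => /orP[/eqP/val_inj <-|ii].
    apply: leq_trans a0_short; rewrite kap0 /height.
    by apply: eq_leq; apply: eq_bigr => j /kapE ->.
  apply: leq_trans (hkap i ii); apply: eq_leq; apply: eq_bigr => j ij.
  by rewrite !kapE // (ltn_trans ii).
move=> a.
have -> : ahead i0 kap' a = ((a <= a0) + ahead i0.+1 kap a)%N.
  rewrite /ahead big_geq_ord kap0; congr (_ + _)%N.
  by apply: eq_bigr => j /kapE ->.
have loadE b : load i0 gam' b = ((b == b1) + mu b)%N.
  rewrite /load big_geq_ord gam0 eq_sym; congr (_ + _)%N.
  by apply: eq_bigr => j /gamE ->.
have -> : (\sum_(b < N) (load i0 gam' b - a) =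
           (a <= mu b1) + \sum_(b < N) (mu b - a))%N.
  rewrite (bigD1 b1) // [in RHS](bigD1 b1) //= loadE eqxx addnA.
  congr (_ + _)%N; first by case: (leqP a (mu b1)); lia.
  by apply: eq_bigr => b /negbTE bb; rewrite loadE bb.
have := dom a; rewrite -/mu => doma.
case: (leqP a a0) => aa0; last by lia.
case: (leqP a (mu b1)) => amu; first by lia.
case: a doma aa0 amu => // a doma aa0 amu.
have := dom a; rewrite aheadS -/mu.
have := a0_min a aa0.
have -> : (\sum_(b < N) (mu b - a) =
           #|[set b | (a < mu b)%N]| + \sum_(b < N) (mu b - a.+1))%N.
  rewrite -sum1dep_card [X in (_ = X + _)%N]big_mkcond -big_split /=; apply: eq_bigr => b _.
  by case: ltnP; lia.
suff : (#|[set b | (a < mu b)%N]| <= d)%N by lia.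
apply: leq_trans card_roots; apply/subset_leq_card/subsetP => b.
rewrite inE => ab; apply: contraLR ab => /b1_max /= mub.
by rewrite -leqNgt (leq_trans mub).
Qed.

Lemma greedy_init : exists kap gam, greedy_inv n kap gam.
Proof.
exists (fun=> 0%N), (fun i => Ordinal (N_big i)); split.
- have prefix_u m : prefix_eq n m = (m == u).
    apply/forallP/eqP => [um|-> j]; last by rewrite eqxx implybT.
    by apply/mnmP => j; have := um j; rewrite ltn_ord => /eqP.
  rewrite /restr_lead (eq_bigl _ _ prefix_u) big_mkcond.
  rewrite (bigD1_seq u) ?msupp_uniq ?mlead_supp //= eqxx.
  rewrite [X in _ + X]big1 ?addr0 => [|m /negbTE -> //].
  rewrite big1 => [|j]; last by rewrite leqNgt ltn_ord.
  by rewrite scaler_eq0 oner_eq0 orbF mleadc_eq0.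
- by move=> i; rewrite leqNgt ltn_ord.
by move=> a; rewrite /ahead big1 // => i; rewrite leqNgt ltn_ord.
Qed.

Lemma greedy_all : exists kap gam, greedy_inv 0 kap gam.
Proof.
suff H s : (s <= n)%N -> exists kap gam, greedy_inv (n - s) kap gam.
  by have := H n (leqnn n); rewrite subnn.
elim: s => [_|s IH sn]; first by rewrite subn0; exact: greedy_init.
have lt : (n - s.+1 < n)%N by lia.
have [kap [gam inv]] := IH (ltnW sn).
apply: (@greedy_step (Ordinal lt) kap gam).
by rewrite /= -subSn // subSS.
Qed.

(** Were a chain numbered [c] used, dominance at [c] would give a value taken more than [c]
    times, at a point where [p] is nonzero. *)
Lemma greedy_columns : vanish_equal c p ->
  exists kap : 'I_n -> 'I_c,
    forall i : 'I_n, (#|[set j : 'I_n | (i < j)%N && (kap j == kap i)]| <= u i)%N.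
Proof.
move=> ep; have [kap [gam [nz hkap dom]]] := greedy_all.
have nz' : subst (fun i => 'X_(gam i)) p != 0.
  apply: contraNneq nz => p0; rewrite -p0 substE /restr_lead.
  by apply/eqP; apply: eq_bigl => m; apply/forallP.
have small b : (load 0 gam b <= c)%N.
  rewrite leqNgt; apply: contraNN nz' => cb; apply/eqP.
  apply: (vanish_equal_subst (k := b) ep); apply: leq_trans cb _.
  by rewrite -sum1dep_card [leqRHS]big_mkcond.
have kapc i : (kap i < c)%N.
  have := dom c; rewrite [X in (_ <= X)%N]big1 => [|b _]; last exact/eqP/small.
  rewrite /ahead (bigD1 i) //= leqn0 addn_eq0 => /andP[].
  by rewrite eqb0 -ltnNge.
exists (fun i => Ordinal (kapc i)) => i.
apply: leq_trans (hkap i isT); rewrite -sum1dep_card.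
by rewrite big_mkcondr.
Qed.

End Greedy.

(** Division algorithm: by [greedy_columns] the leading monomial of [p] is divisible by
    that of a column product, which lies in the ideal as well. Quantifying over the subspaces [W]
    keeps track of the degrees without naming a span. *)
Lemma vanish_equal_colprod (K : fieldType) n c k (W : {mpoly K[n]} -> Prop) :
  subspace W ->
  (forall (m : 'X_{1..n}) (kap : 'I_n -> 'I_c),
     ('X_[m] * colprod K kap) \is k.-homog -> W ('X_[m] * colprod K kap)) ->
  forall p, p \is k.-homog -> vanish_equal c p -> W p.
Proof.
move=> [W0 WD] Wcol; elim/mleadrect => p IH hp ep.
have [->|nz] := eqVneq p 0; first exact: W0.
have bnd i : (mlead p i < (\max_j mlead p j).+1)%N by rewrite ltnS leq_bigmax.
have [kap hkap] := greedy_columns nz hp bnd ep.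
set u := mlead p in hkap *; set F := colprod K kap.
have Fu : (mlead F <= u)%MM by apply/mnm_lepP => i; rewrite mlead_colprod.
pose Q : {mpoly K[n]} := 'X_[u - mlead F] * F.
have nzF : F != 0 := colprod_neq0 K kap.
have nzX (m : 'X_{1..n}) : 'X_[K, m] != 0.
  by rewrite -mleadc_eq0 mleadXm mcoeffX eqxx oner_neq0.
have leadQ : mlead Q = u by rewrite mleadM // mleadXm submK.
have nzQ : mleadc Q != 0 by rewrite mleadc_eq0 mulf_neq0.
have hQ : Q \is k.-homog.
  have -> : k = (mdeg (u - mlead F) + mdeg (mlead F))%N.
    by rewrite -mdegD submK //; have /dhomogP/(_ _ (mlead_supp nz)) := hp.
  apply: dhomogM.
    by rewrite dhomogX.
  exact: colprod_homog.
pose a := mleadc p / mleadc Q.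
have WQ : W Q by exact: Wcol.
have eQ : vanish_equal c Q by apply: vanish_equalM; exact: colprod_vanish_equal.
have -> : p = a *: Q + (p - a *: Q) by rewrite addrC subrK.
apply: (WD) => //; set q := p - a *: Q.
have eq : vanish_equal c q.
  have [_ eD] := vanish_equal_subspace K n c.
  by rewrite /q addrC -scaleNr; apply: eD.
have hq : q \is k.-homog by rewrite rpredB // rpredZ.
have [->|nzq] := eqVneq q 0; first exact: W0.
apply: IH => //.
rewrite lt_neqAle; apply/andP; split; last first.
  apply: le_trans (mleadB_le _ _) _; rewrite leUx lexx /=.
  by apply: le_trans (mleadZ_le _ _) _; rewrite leadQ.
apply: contraNneq nzq => E; rewrite -mleadc_eq0 E mcoeffB mcoeffZ.
by move: nzQ; rewrite -/u /a leadQ => nzQ; rewrite divfK // subrr.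
Qed.

(** * Evening out the lengths of the columns *)

Section IdealGen.
Variables (R : comNzRingType) (S : R -> Prop).

Lemma ideal_genD p q : ideal_gen S p -> ideal_gen S q -> ideal_gen S (p + q).
Proof.
move=> [m [c [g [Sg ->]]]] [m' [c' [g' [Sg' ->]]]].
exists (m + m')%N,
  (fun i => match split i with inl j => c j | inr j => c' j end),
  (fun i => match split i with inl j => g j | inr j => g' j end).
split=> [i|]; first by case: (split i).
rewrite big_split_ord /=; congr (_ + _); apply: eq_bigr => i _.
  by rewrite -[lshift _ _]/(unsplit (inl i)) unsplitK.
by rewrite -[rshift _ _]/(unsplit (inr i)) unsplitK.
Qed.

Lemma ideal_genM a p : ideal_gen S p -> ideal_gen S (a * p).
Proof.
move=> [m [c [g [Sg ->]]]]; exists m, (fun i => a * c i), g; split=> //.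
by rewrite mulr_sumr; apply: eq_bigr => i _; rewrite mulrA.
Qed.

Lemma ideal_gen_in p : S p -> ideal_gen S p.
Proof.
by move=> Sp; exists 1%N, (fun=> 1), (fun=> p); split=> //; rewrite big_ord1 mul1r.
Qed.

End IdealGen.

Section Balance.
Variables (K : fieldType) (n c : nat).
Implicit Types (kap : 'I_n -> 'I_c) (a b : 'I_c) (x z : 'I_n).
Local Notation V i := ('X_i : {mpoly K[n]}).

Definition class_size kap a : nat := #|[set i | kap i == a]|.

(** The configurations in which [colprod_move] is not applicable. *)
Definition balanced kap : Prop :=
  forall a b, (class_size kap b <= 1)%N -> (class_size kap a <= (class_size kap b).+1)%N.

Definition recolor kap x b : 'I_n -> 'I_c := fun i => if i == x then b else kap i.

Definition point_factors kap x : {mpoly K[n]} :=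
  \prod_(i | (i != x) && (kap i == kap x)) (V x - V i).

Definition other_factors kap x : {mpoly K[n]} :=
  \prod_(p : 'I_n * 'I_n | [&& (p.1 < p.2)%N && (kap p.1 == kap p.2), p.1 != x & p.2 != x])
     (V p.1 - V p.2).

(** Separating the factors that involve [x] isolates the dependence on the column of
    [x], at the price of a sign. *)
Lemma colprod_split kap x :
  exists e : bool, colprod K kap = (-1) ^+ e * point_factors kap x * other_factors kap x.
Proof.
pose e := #|[pred i : 'I_n | (i < x)%N && (kap i == kap x)]|.
exists (odd e); rewrite signr_odd.
rewrite /colprod (bigID (fun p : 'I_n * 'I_n => p.1 == x)) /=.
rewrite [X in _ * X](bigID (fun p : 'I_n * 'I_n => p.2 == x)) /= mulrA.
congr (_ * _); last by apply: eq_bigl => -[i j] /=; rewrite -andbA.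
rewrite /point_factors (bigID (fun i : 'I_n => (x < i)%N)) /= mulrCA.
congr (_ * _).
  rewrite (reindex_onto (fun i : 'I_n => (x, i)) snd) /=; last first.
    by move=> [i j] /= /andP[_ /eqP->].
  apply: eq_bigl => i; rewrite /= !eqxx !andbT [kap i == _]eq_sym.
  have -> : (i != x) = (i != x :> nat) by [].
  by case: (ltngtP x i); rewrite ?andbF ?andbT.
rewrite (reindex_onto (fun i : 'I_n => (i, x)) fst) /=; last first.
  by move=> [i j] /= /andP[_ /eqP->].
transitivity (\prod_(i in [pred i : 'I_n | (i < x)%N && (kap i == kap x)])
                - (V x - V i)); last first.
  rewrite prodrN; congr (_ * _); apply: eq_bigl => i; rewrite inE.
  have -> : (i != x) = (i != x :> nat) by [].
  by case: (ltngtP x i); rewrite ?andbF ?andbT.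
apply: congr_big => // i; last by rewrite opprB.
rewrite /= !eqxx !andbT inE; have -> : (i != x) = (i != x :> nat) by [].
by case: (ltngtP x i); rewrite ?andbF ?andbT.
Qed.

Lemma other_factors_recolor kap x b : other_factors (recolor kap x b) x = other_factors kap x.
Proof.
apply: eq_bigl => -[i j] /=; rewrite /recolor.
by case: (eqVneq i x) => [|_]; rewrite ?andbF //; case: (eqVneq j x); rewrite ?andbF.
Qed.

Lemma sign_mul_ideal (I : {mpoly K[n]} -> Prop) (e : bool) p q :
  (forall g p, I p -> I (g * p)) -> I ((-1) ^+ e * p * q) -> I (p * q).
Proof.
by move=> IM /(IM ((-1) ^+ e)); rewrite !mulrA -expr2 sqrr_sign mul1r.
Qed.

Lemma point_factors_recolor kap x b : kap x != b ->
  point_factors (recolor kap x b) x = \prod_(i | kap i == b) (V x - V i).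
Proof.
move=> xb; apply: eq_bigl => i; rewrite /recolor eqxx.
by case: eqVneq => [->|]; rewrite // (negbTE xb).
Qed.

(** If column [b] is empty, moving [x] there only removes factors. If [b = {s}], choose [x]
    and [z] in column [a] and write [x - z = (x - s) - (z - s)]: the first term is a multiple of the
    product in which [x] has moved next to [s], the second one of that in which [z] has. *)
Lemma colprod_move (I : {mpoly K[n]} -> Prop) kap a b :
    (forall g p, I p -> I (g * p)) -> (forall p q, I p -> I q -> I (p + q)) ->
    (class_size kap b <= 1)%N -> (class_size kap b + 2 <= class_size kap a)%N ->
    (forall x, kap x = a -> I (colprod K (recolor kap x b))) ->
  I (colprod K kap).
Proof.
move=> IM ID b1 ab Irec.
have ne_ab : a != b by apply: contraTneq ab => ->; lia.
have Irest x : kap x = a -> I (\prod_(i | kap i == b) (V x - V i) * other_factors kap x).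
  move=> xa; have := Irec x xa.
  have [e ->] := colprod_split (recolor kap x b) x.
  by rewrite other_factors_recolor point_factors_recolor ?xa // => /(sign_mul_ideal IM).
have /card_gt1P[x [z []]] : (1 < class_size kap a)%N by lia.
rewrite !inE => /eqP xa /eqP za xz.
have [ex Ex] := colprod_split kap x; have [ez Ez] := colprod_split kap z.
have [b0|bpos] := posnP (class_size kap b).
  rewrite Ex; apply: (IM).
  have := Irest x xa; rewrite big_pred0 ?mul1r // => i; apply/negbTE.
  by move/eqP: b0; rewrite cards_eq0 => /eqP/setP/(_ i); rewrite !inE => ->.
have /cards1P[s sb] : class_size kap b == 1%N by rewrite eqn_leq b1 bpos.
have bE i : (kap i == b) = (i == s) by move/setP/(_ i): sb; rewrite !inE.
have {}Irest y : kap y = a -> I ((V y - V s) * other_factors kap y).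
  by move=> /Irest; rewrite (eq_bigl _ _ bE) big_pred1_eq.
pose M y y' := \prod_(i | ((i != y) && (kap i == kap y)) && (i != y')) (V y - V i).
have starE y y' : kap y = kap y' -> y' != y -> point_factors kap y = (V y - V y') * M y y'.
  by move=> yy' ne; rewrite /point_factors (bigD1 y') //= ne yy' eqxx.
have xz' : kap x = kap z by rewrite xa za.
have zx : z != x by rewrite eq_sym.
(* Both products come from the same [colprod kap], after cancelling [x - z]. *)
have Mxz : exists e : bool, M x z * other_factors kap x = (-1) ^+ e * (M z x * other_factors kap z).
  have nz : V x - V z != 0.
    rewrite subr_eq0; apply: contraNneq xz => /(congr1 (@mlead n K)).
    by rewrite !mleadXm => /eqP; rewrite eq_mnm1.
  exists (~~ (ex (+) ez)); apply: (mulfI nz).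
  move: Ez; rewrite Ex (starE x z) // (starE z x) //.
  move/(congr1 (fun t => (-1) ^+ ex * t)); rewrite !mulrA -expr2 sqrr_sign mul1r => ->.
  by rewrite signrN signr_addb; ring.
have [e Me] := Mxz.
have -> : colprod K kap = ((-1) ^+ ex * M x z) * ((V x - V s) * other_factors kap x) +
    ((-1) ^+ ex * (- (-1) ^+ e) * M z x) * ((V z - V s) * other_factors kap z).
  rewrite Ex (starE x z) //.
  transitivity ((-1) ^+ ex * (V x - V s) * (M x z * other_factors kap x) -
                (-1) ^+ ex * (V z - V s) * (M x z * other_factors kap x)); first by ring.
  by rewrite {2}Me; ring.
by apply: (ID); apply: (IM); apply: (Irest).
Qed.

Lemma class_size_recolor kap a b x d : a != b -> kap x = a ->
  (class_size (recolor kap x b) d + (d == a) = class_size kap d + (d == b))%N.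
Proof.
move=> ab xa; rewrite /class_size (cardsD1 x) [in RHS](cardsD1 x) !inE /recolor eqxx xa.
have -> : [set i | (if i == x then b else kap i) == d] :\ x = [set i | kap i == d] :\ x.
  by apply/setP => i; rewrite !inE; case: eqP.
rewrite ![_ == d]eq_sym; lia.
Qed.

(** Each move decreases the sum of the squares of the column lengths. *)
Lemma colprod_balance (I : {mpoly K[n]} -> Prop) :
    (forall g p, I p -> I (g * p)) -> (forall p q, I p -> I q -> I (p + q)) ->
    (forall kap, balanced kap -> I (colprod K kap)) ->
  forall kap, I (colprod K kap).
Proof.
move=> IM ID Ibal kap; have [m] := ubnP (\sum_a class_size kap a ^ 2)%N.
elim: m kap => // m IH kap; rewrite ltnS => le_m.
case: (boolP [exists a, exists b,
    (class_size kap b <= 1) && (class_size kap b + 2 <= class_size kap a)]%N).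
  case/existsP=> a /existsP[b /andP[b1 ab]].
  have ne_ab : a != b by apply: contraTneq ab => ->; lia.
  apply: (colprod_move IM ID b1 ab) => x xa; apply: IH; apply: leq_trans le_m.
  rewrite (bigD1 a) //= (bigD1 b) 1?eq_sym //= [leqRHS](bigD1 a) //=.
  rewrite [X in (_ < _ + X)%N](bigD1 b) 1?eq_sym //=.
  rewrite (eq_bigr (fun d => class_size kap d ^ 2)%N) => [|d /andP[/negbTE da /negbTE db]].
    have := class_size_recolor a ne_ab xa; have := class_size_recolor b ne_ab xa.
    rewrite !eqxx (negbTE ne_ab) eq_sym (negbTE ne_ab) !addnA ltn_add2r -!mulnn; nia.
  by have := class_size_recolor d ne_ab xa; rewrite da db !addn0 => ->.
move/existsPn => H; apply: Ibal => a b b1.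
by have /existsPn/(_ b) := H a; rewrite b1 /= -ltnNge; lia.
Qed.

Lemma class_size_sum kap : (\sum_a class_size kap a = n)%N.
Proof.
rewrite -[RHS]card_ord -sum1_card (partition_big kap xpredT) //=.
by apply: eq_bigr => a _; rewrite /class_size -sum1dep_card.
Qed.

Lemma balanced_le2 kap : (n <= 2 * c)%N -> balanced kap -> forall a, (class_size kap a <= 2)%N.
Proof.
move=> nc bal a; rewrite leqNgt; apply/negP => a3.
have : (\sum_(b | b != a) 2 <= \sum_(b | b != a) class_size kap b)%N.
  by apply: leq_sum => b _; rewrite ltnNge; apply/negP => b1; have := bal a b b1; lia.
have := class_size_sum kap; rewrite (bigD1 a) //= sum_nat_const cardC1 card_ord.
have := ltn_ord a; lia.
Qed.

Lemma balanced_gt0 kap : (c <= n)%N -> balanced kap -> forall a, (0 < class_size kap a)%N.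
Proof.
move=> cn bal a; rewrite lt0n; apply/eqP => a0.
have : (\sum_(b | b != a) class_size kap b <= \sum_(b | b != a) 1)%N.
  by apply: leq_sum => b _; have := bal b a; rewrite a0; apply.
have := class_size_sum kap; rewrite (bigD1 a) //= a0 sum_nat_const cardC1 card_ord.
have := ltn_ord a; lia.
Qed.

Lemma balanced_odd kap : n = (2 * c).+1 -> balanced kap ->
  forall a, (2 <= class_size kap a <= 3)%N.
Proof.
move=> nc bal.
have [a a3] : exists a, (3 <= class_size kap a)%N.
  apply/existsP; apply: contraT; rewrite negb_exists => /forallP H.
  have : (\sum_a class_size kap a <= \sum_(a < c) 2)%N.
    by apply: leq_sum => b _; have := H b; rewrite -ltnNge.
  by rewrite class_size_sum sum_nat_const card_ord; lia.
have ge2 b : (2 <= class_size kap b)%N.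
  by rewrite ltnNge; apply/negP => b1; have := bal a b b1; lia.
move=> b; rewrite ge2 /= leqNgt; apply/negP => b4.
have [ba|ba] := eqVneq b a.
  have : (\sum_(b | b != a) 2 <= \sum_(b | b != a) class_size kap b)%N by apply: leq_sum.
  have := class_size_sum kap; rewrite (bigD1 a) //= sum_nat_const cardC1 card_ord -ba.
  have := ltn_ord a; lia.
have : (\sum_(i | (i != a) && (i != b)) 2 <= \sum_(i | (i != a) && (i != b)) class_size kap i)%N.
  by apply: leq_sum.
have := class_size_sum kap; rewrite (bigD1 a) //= (bigD1 b) //=.
have -> : (\sum_(i | (i != a) && (i != b)) 2 = 2 * c - 4)%N.
  have := sum_nat_const [pred i : 'I_c | true] 2; rewrite (bigD1 a) //= (bigD1 b) //=.
  by rewrite card_ord; lia.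
have := ltn_ord a; lia.
Qed.

End Balance.

(** * Column products and tableaux *)

Lemma fiber_inj (A B : finType) (C : eqType) (f : A -> C) (g : B -> C) :
  (forall z, #|[set x | f x == z]| <= #|[set y | g y == z]|)%N ->
  exists T : A -> B, injective T /\ forall x, g (T x) = f x.
Proof.
move=> fg.
pose F x := enum [set x' | f x' == f x]; pose G x := enum [set y | g y == f x].
have lt_G x : (index x (F x) < size (G x))%N.
  have : (index x (F x) < size (F x))%N by rewrite index_mem mem_enum inE.
  by move/leq_trans; apply; rewrite -!cardE.
have ex_T x : exists y, nth None (map Some (G x)) (index x (F x)) == Some y.
  case E : (G x) (lt_G x) => [|y0 s] // lt; exists (nth y0 (y0 :: s) (index x (F x))).
  by rewrite (nth_map y0).
pose T x := xchoose (ex_T x).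
have TE x y0 : T x = nth y0 (G x) (index x (F x)).
  have : nth None (map Some (G x)) (index x (F x)) = Some (T x).
    by apply/eqP; exact: (xchooseP (ex_T x)).
  by rewrite (nth_map y0) ?lt_G // => -[].
have gT x : g (T x) = f x.
  by have := mem_nth (T x) (lt_G x); rewrite -TE mem_enum inE => /eqP.
exists T; split=> // x x' TT; have ff : f x = f x' by rewrite -!gT TT.
have FF : F x' = F x by rewrite /F ff.
have GG : G x' = G x by rewrite /G ff.
move: TT; rewrite (TE x (T x)) (TE x' (T x)) GG FF => /eqP.
rewrite nth_uniq ?enum_uniq ?lt_G //; last by rewrite -FF -GG lt_G.
have xF : x \in F x by rewrite mem_enum inE.
have xF' : x' \in F x by rewrite -FF mem_enum inE.
by move/eqP/(congr1 (nth x (F x))); rewrite !nth_index.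
Qed.

(** Used twice: to match the columns of a diagram with those of equal length of a column
    product, then to match the boxes with the indices. *)
Lemma fiber_bij (A B : finType) (C : eqType) (f : A -> C) (g : B -> C) :
  (forall z, #|[set x | f x == z]| = #|[set y | g y == z]|) ->
  exists T : A -> B, bijective T /\ forall x, g (T x) = f x.
Proof.
move=> fg; have [x|T [injT gT]] := @fiber_inj A B C f g; first by rewrite fg.
have [y|T' [injT' _]] := @fiber_inj B A C g f; first by rewrite fg.
by exists T; split=> //; apply: inj_card_bij => //; exact: leq_card injT'.
Qed.

(** A product of antisymmetric factors over unordered pairs depends on the chosen
    orientations only up to sign. Here pairs in a column are oriented by rows in a Specht polynomial
    and by indices in a column product. *)
Lemma prod_orient (R : comNzRingType) (T : finType) (r o1 o2 : rel T) (G : T -> T -> R) :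
    (forall x y, r x y = r y x) -> (forall x y, G y x = - G x y) ->
    (forall x, o1 x x = false) -> (forall x, o2 x x = false) ->
    (forall x y, x != y -> r x y -> o1 y x = ~~ o1 x y) ->
    (forall x y, x != y -> r x y -> o2 y x = ~~ o2 x y) ->
  exists e : bool, \prod_(p : T * T | r p.1 p.2 && o1 p.1 p.2) G p.1 p.2 =
    (-1) ^+ e * \prod_(p : T * T | r p.1 p.2 && o2 p.1 p.2) G p.1 p.2.
Proof.
move=> r_sym G_anti o1_irr o2_irr o1_tot o2_tot.
pose N := #|[pred p : T * T | (r p.1 p.2 && o2 p.1 p.2) && ~~ o1 p.1 p.2]|.
exists (odd N); rewrite signr_odd.
rewrite (bigID (fun p : T * T => o2 p.1 p.2)) /=.
rewrite [in RHS](bigID (fun p : T * T => o1 p.1 p.2)) /= mulrCA.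
congr (_ * _); first by apply: eq_bigl => p; rewrite -!andbA [o1 _ _ && _]andbC.
transitivity (\prod_(p in [pred p : T * T | (r p.1 p.2 && o2 p.1 p.2) && ~~ o1 p.1 p.2])
                (- G p.1 p.2)); last first.
  by rewrite prodrN; congr (_ * _); apply: eq_bigl => p; rewrite inE.
rewrite (reindex_inj (inv_inj (f := fun p : T * T => (p.2, p.1)) _)) /=; last by case.
apply: congr_big => // -[x y] /=.
rewrite inE /= r_sym; have [->|ne] := eqVneq x y; first by rewrite o1_irr o2_irr !andbF.
case rxy : (r x y) => //=; rewrite (o1_tot x y) // (o2_tot x y) //.
by case: (o1 x y); case: (o2 x y).
Qed.

(** The sum determines how often the larger value is taken. *)
Lemma two_values_fibers (C : finType) (f g : C -> nat) m :
    (forall x, m <= f x <= m.+1)%N -> (forall x, m <= g x <= m.+1)%N ->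
    (\sum_x f x = \sum_x g x)%N ->
  forall z, #|[set x | f x == z]| = #|[set x | g x == z]|.
Proof.
have count_top (h : C -> nat) : (forall x, m <= h x <= m.+1)%N ->
    (\sum_x h x = m * #|C| + #|[set x | h x == m.+1]|)%N.
  move=> hm; rewrite -sum1dep_card [X in (_ + X)%N]big_mkcond /=.
  have -> : (m * #|C| = \sum_(x : C) m)%N by rewrite sum_nat_const mulnC.
  rewrite -big_split /=; apply: eq_bigr => x _; have := hm x.
  by case: eqP; lia.
have count_all (h : C -> nat) : (forall x, m <= h x <= m.+1)%N ->
    (#|C| = #|[set x | h x == m]| + #|[set x | h x == m.+1]|)%N.
  move=> hm; have -> : #|C| = (\sum_(x : C) 1)%N by rewrite sum1_card.
  rewrite -!sum1dep_card !(big_mkcond (fun x => _ == _)) /=.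
  rewrite -big_split /=; apply: eq_bigr => x _; have := hm x.
  by do 2!case: eqP; lia.
have other (h : C -> nat) z : (forall x, m <= h x <= m.+1)%N -> z != m -> z != m.+1 ->
    #|[set x | h x == z]| = 0%N.
  move=> hm zm zm1; apply/eqP; rewrite cards_eq0; apply/eqP/setP => x; rewrite !inE.
  by have := hm x; apply: contraTF => /eqP ->; lia.
move=> hf hg; rewrite (count_top f) // (count_top g) // => /addnI top z.
have [->|zm] := eqVneq z m.
  by apply: (@addIn #|[set x | f x == m.+1]|); rewrite -count_all // top -count_all.
have [->//|zm1] := eqVneq z m.+1.
by rewrite !other.
Qed.

Section Tableau.
Variables (K : fieldType) (n c : nat) (la : seq nat).
Hypothesis la_head : head 0%N la = c.
Hypothesis la_le : forall i, (nth 0 la i <= c)%N.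

Lemma bcol_lt (b : box la) : (bcol b < c)%N.
Proof. exact: leq_trans (ltn_ord (tagged b)) (la_le _). Qed.

Lemma box_eq (b b' : box la) : bcol b = bcol b' -> brow b = brow b' -> b = b'.
Proof.
case: b b' => [i j] [i' j'] cc rr.
have ii : i = i' by apply: val_inj; exact: rr.
by case: i' / ii j' cc {rr} => j' /= cc; congr Tagged; apply: val_inj.
Qed.

Lemma specht_polyE (T : box la -> 'I_n) :
  specht_poly K T = \prod_(p : box la * box la |
      (bcol p.1 == bcol p.2) && (brow p.1 < brow p.2)%N) ('X_(T p.1) - 'X_(T p.2)).
Proof.
rewrite /specht_poly la_head.
rewrite (partition_big (fun p : box la * box la => Ordinal (bcol_lt p.1)) xpredT) //=.
apply: eq_bigr => j _; rewrite /specht_col; apply: eq_bigl => -[b b'] /=.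
rewrite -val_eqE /=; case: (eqVneq (bcol b) j) => [->|_]; last by rewrite andbF.
by rewrite eq_sym andbT.
Qed.

(** Among more than [c] indices two are in the same column. *)
Lemma specht_poly_vanish_equal (T : box la -> 'I_n) : tableau T -> vanish_equal c (specht_poly K T).
Proof.
move=> bijT S cS; rewrite specht_polyE.
have [b [b' [bS b'S bb col]]] : exists b b', [/\ b \in T @^-1: S, b' \in T @^-1: S,
    b != b' & Ordinal (bcol_lt b) = Ordinal (bcol_lt b')].
  apply: pigeonhole; rewrite card_ord on_card_preimset //.
  by case: bijT => T' TK TK'; exists T' => x _; rewrite ?TK ?TK'.
have {}col : bcol b = bcol b' := congr1 val col.
wlog lt_bb : b b' bS b'S bb col / (brow b < brow b')%N => [IH|].
  case: (ltngtP (brow b) (brow b')) => [|lt|/(box_eq col)/eqP].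
  - exact: IH.
  - by apply: (IH b' b) => //; rewrite eq_sym.
  - by rewrite (negbTE bb).
rewrite (bigD1 (b, b')) /=; last by rewrite col eqxx.
rewrite !rmorphM /= [X in X * _]kill_shift_sub ?mul0r //.
  by move: bS; rewrite inE.
by move: b'S; rewrite inE.
Qed.

Definition col_height (j : 'I_c) : nat := #|[set b : box la | bcol b == j]|.

(** Columns of two possible lengths and of known total length are determined up to
    reordering, hence a column product of this kind is the Specht polynomial of some tableau. *)
Lemma colprod_specht (kap : 'I_n -> 'I_c) m :
    (forall j, m <= col_height j <= m.+1)%N ->
    (forall a, m <= class_size kap a <= m.+1)%N ->
    #|box la| = n ->
  exists (T : box la -> 'I_n) (e : bool),
    tableau T /\ colprod K kap = (-1) ^+ e * specht_poly K T.
Proof.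
move=> hm km card_la.
have sumE : (\sum_j col_height j = \sum_a class_size kap a)%N.
  rewrite class_size_sum -card_la -sum1_card.
  rewrite (partition_big (fun b : box la => Ordinal (bcol_lt b)) xpredT) //=.
  by apply: eq_bigr => j _; rewrite /col_height -sum1dep_card.
have [s [bij_s sE]] := fiber_bij (two_values_fibers hm km sumE).
have [s' sK s'K] := bij_s.
have [|T [bijT TE]] := @fiber_bij _ _ _ (@bcol la) (fun i => val (s' (kap i))).
  move=> z; have [zc|cz] := ltnP z c.
    have := sE (Ordinal zc); rewrite /col_height => <-; apply: eq_card => i.
    rewrite !inE; apply/eqP/eqP => [->|iz]; first by rewrite sK.
    by rewrite -[kap i]s'K; congr s; apply: val_inj.
  transitivity 0%N; last apply/esym; apply/eqP; rewrite cards_eq0; apply/eqP/setP => x;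
    rewrite !inE ltn_eqF //.
    exact: leq_trans (bcol_lt x) cz.
  exact: leq_trans (ltn_ord _) cz.
have [T' TK T'K] := bijT.
pose g (b b' : box la) : {mpoly K[n]} := 'X_(T b) - 'X_(T b').
have T_tot x y : x != y -> bcol x == bcol y -> (T y < T x)%N = ~~ (T x < T y)%N.
  move=> xy _; case: (ltngtP (T x) (T y)) => // /ord_inj/(can_inj TK) yx.
  by rewrite yx eqxx in xy.
have row_tot (x y : box la) : x != y -> bcol x == bcol y ->
    (brow y < brow x)%N = ~~ (brow x < brow y)%N.
  move=> xy /eqP col; case: (ltngtP (brow x) (brow y)) => // yx.
  by rewrite (box_eq col yx) eqxx in xy.
have [e E] := @prod_orient _ _ (fun b b' => bcol b == bcol b')
  (fun b b' => T b < T b')%N (fun b b' => brow b < brow b')%N g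
  (fun x y => eq_sym _ _) (fun x y => esym (opprB _ _))
  (fun x => ltnn _) (fun x => ltnn _) T_tot row_tot.
exists T, e; split=> //; rewrite specht_polyE -E /colprod.
rewrite (reindex (fun p : box la * box la => (T p.1, T p.2))) /=; last first.
  exists (fun p => (T' p.1, T' p.2)) => -[a b] _ /=; first by rewrite !TK.
  by rewrite !T'K.
apply: eq_bigl => -[b b'] /=; rewrite andbC -!TE; congr (_ && _).
by rewrite (inj_eq val_inj) (inj_eq (can_inj s'K)).
Qed.

End Tableau.

(** * Specht ideals as vanishing ideals *)

Section Boxes.
Variable la : seq nat.

Lemma sum_box (F : nat -> nat) :
  (\sum_(b : box la) F (bcol b) = \sum_(i < size la) \sum_(j < nth 0 la i) F j)%N.
Proof.
by rewrite (sig_big_dep (fun _ => true) (fun _ _ => true) (fun i j => F (nat_of_ord j))).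
Qed.

Lemma card_box : #|box la| = (\sum_(i < size la) nth 0 la i)%N.
Proof.
have -> : #|box la| = (\sum_(b : box la) 1)%N by rewrite sum1_card.
rewrite (sum_box (fun=> 1%N)); apply: eq_bigr => i _.
by rewrite sum1_card card_ord.
Qed.

Lemma col_heightE c (j : 'I_c) :
  col_height la j = (\sum_(i < size la) (j < nth 0 la i))%N.
Proof.
rewrite /col_height -sum1dep_card big_mkcond /=.
rewrite (sum_box (fun l => if l == j then 1 else 0)%N); apply: eq_bigr => i _.
rewrite -big_mkcond /= sum1dep_card; case: ltnP => [ji|ij]; last first.
  apply/eqP; rewrite cards_eq0; apply/eqP/setP => l; rewrite !inE ltn_eqF //.
  exact: leq_trans (ltn_ord l) ij.
apply/eqP/cards1P; exists (Ordinal ji); apply/setP => l.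
by rewrite !inE -val_eqE.
Qed.

End Boxes.

Section SpechtEquals.
Variables (K : fieldType) (n c m : nat) (la : seq nat).
Hypothesis la_head : head 0%N la = c.
Hypothesis la_le : forall i, (nth 0 la i <= c)%N.
Hypothesis card_la : #|box la| = n.
Hypothesis heights : forall j : 'I_c, (m <= col_height la j <= m.+1)%N.
Hypothesis balanced_heights : forall kap : 'I_n -> 'I_c,
  balanced kap -> forall a, (m <= class_size kap a <= m.+1)%N.

Lemma specht_ideal_vanish_equal p : specht_ideal K n la p -> vanish_equal c p.
Proof.
case=> l [a [g [Sg ->]]]; have [e0 eD] := vanish_equal_subspace K n c.
elim/big_rec: _ => // i q _ eq; rewrite -[_ * _]scale1r; apply: eD => //.
by apply: vanish_equalM; have [T [tT ->]] := Sg i; apply: specht_poly_vanish_equal.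
Qed.

Lemma vanish_equal_specht_ideal k p :
  p \is k.-homog -> vanish_equal c p -> specht_ideal K n la p.
Proof.
have IM := @ideal_genM {mpoly K[n]}.
move: p; apply: (vanish_equal_colprod (c := c)) => [|u kap _]; first exact: ideal_gen_subspace.
apply: (IM); apply: colprod_balance => [||kap' bal]; [exact: IM | exact: ideal_genD |].
have [T [e [tT ->]]] := colprod_specht K la_head la_le heights (balanced_heights bal) card_la.
by apply: (IM); apply: ideal_gen_in; exists T.
Qed.

(** Bases in degree [k] only involve homogeneous elements, on which the two ideals
    agree. *)
Lemma hilbert_specht k :
  hilbert_fun (specht_ideal K n la) k = hilbert_fun (@vanish_equal K n c) k.
Proof.
apply: hilbert_fun_eq; first exact: ideal_gen_subspace.
have [b [hb fb sb]] := quot_dim_hilbert k (vanish_equal_subspace K n c).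
exists b; split=> // [a /specht_ideal_vanish_equal|p hp]; first exact: fb.
have [a ea] := sb p hp; exists a; apply: (vanish_equal_specht_ideal (k := k)) ea.
by rewrite rpredB // rpred_sum // => i _; rewrite rpredZ ?hb.
Qed.

End SpechtEquals.

Lemma hilbert_two_rows (K : fieldType) n d k : (1 <= d)%N -> (d <= n - d)%N ->
  hilbert_fun (specht_ideal K n [:: n - d; d]%N) k = hilbert_fun (@vanish_equal K n (n - d)) k.
Proof.
move=> d1 dn; apply: (@hilbert_specht K n (n - d) 1) => //.
- by move=> [|[|i]] //=; rewrite nth_nil.
- by rewrite card_box /= !big_ord_recl big_ord0 /=; lia.
- by move=> j; rewrite col_heightE /= !big_ord_recl big_ord0 /= ltn_ord; case: (j < d)%N.
move=> kap bal a; rewrite (balanced_le2 _ bal) ?andbT; last by lia.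
by apply: balanced_gt0 => //; lia.
Qed.

Lemma hilbert_odd (K : fieldType) n d k : (1 <= d)%N -> n = (2 * d + 1)%N ->
  hilbert_fun (specht_ideal K n [:: d; d; 1]%N) k = hilbert_fun (@vanish_equal K n d) k.
Proof.
move=> d1 nE; apply: (@hilbert_specht K n d 2) => //.
- by move=> [|[|[|i]]] //=; rewrite nth_nil.
- by rewrite card_box /= !big_ord_recl big_ord0 /=; lia.
- by move=> j; rewrite col_heightE /= !big_ord_recl big_ord0 /= ltn_ord; case: (j < 1)%N.
by move=> kap bal a; apply: balanced_odd => //; lia.
Qed.

(** * The filtration by the degree in v *)

Section Subspaces.
Variables (K : fieldType) (n : nat) (W : {mpoly K[n]} -> Prop).
Hypothesis subW : subspace W.

Lemma subspaceD p q : W p -> W q -> W (p + q).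
Proof. by case: subW => _ WD Wp Wq; rewrite -[p]scale1r; apply: WD. Qed.

Lemma subspaceZ a p : W p -> W (a *: p).
Proof. by case: subW => W0 WD Wp; rewrite -[_ *: _]addr0; apply: WD. Qed.

Lemma subspaceB p q : W p -> W q -> W (p - q).
Proof. by move=> Wp Wq; apply: subspaceD => //; rewrite -scaleN1r; apply: subspaceZ. Qed.

Lemma subspace_bigsum (T : Type) (s : seq T) (P : pred T) (F : T -> {mpoly K[n]}) :
  (forall t, P t -> W (F t)) -> W (\sum_(t <- s | P t) F t).
Proof. by move=> WF; apply: big_ind => //; [case: subW | exact: subspaceD]. Qed.

End Subspaces.

Section FinBasis.
Variables (K : fieldType) (n k : nat) (I : {mpoly K[n]} -> Prop).

Lemma quot_dim_fin (T : finType) (b : T -> {mpoly K[n]}) :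
    (forall t, b t \is k.-homog) ->
    (forall a : T -> K, I (\sum_t a t *: b t) -> forall t, a t = 0) ->
    (forall p, p \is k.-homog -> exists a : T -> K, I (p - \sum_t a t *: b t)) ->
  quot_dim I k #|T|.
Proof.
move=> hb fb sb; exists (b \o enum_val).
have sumE (a : 'I_#|T| -> K) :
    \sum_i a i *: (b \o enum_val) i = \sum_t a (enum_rank t) *: b t.
  rewrite (reindex enum_rank) /=; last exact/onW_bij/enum_rank_bij.
  by apply: eq_bigr => t _; rewrite enum_rankK.
split=> [i|a|p hp]; first exact: hb.
  by rewrite sumE => /fb a0 i; rewrite -[i]enum_valK a0.
have [a Ia] := sb p hp; exists (a \o enum_val); rewrite sumE.
congr (I (_ - _)): Ia; apply: eq_bigr => t _ /=.
by rewrite enum_rankK.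
Qed.

(** The dimension of a quotient may be computed from any two bases; comparing a basis of
    monomials with one adapted to the filtration yields the Hilbert functions. *)
Lemma quot_dim_uniq m m' : subspace I -> quot_dim I k m -> quot_dim I k m' -> m = m'.
Proof. by move=> sI /(hilbert_fun_eq sI) <- /(hilbert_fun_eq sI). Qed.

End FinBasis.

(** The ideal generated by homogeneous elements is graded. *)
Lemma pihomog_mull (K : fieldType) n k d (g F : {mpoly K[n]}) :
  F \is d.-homog -> exists g', pihomog mdeg k (g * F) = g' * F.
Proof.
move=> hF; rewrite [g]mpolyE mulr_suml raddf_sum /=.
elim/big_rec: _ => [|u q _ [g' ->]]; first by exists 0; rewrite mul0r.
have hu : g@_u *: 'X_[u] * F \is (mdeg u + d).-homog.
  by rewrite dhomogM // rpredZ // dhomogX.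
have [idk|ne] := eqVneq (mdeg u + d)%N k.
  exists (g@_u *: 'X_[u] + g'); rewrite mulrDl; congr (_ + _).
  by apply: pihomog_dE; rewrite -idk.
by exists g'; rewrite (pihomog_ne0 ne hu) add0r.
Qed.

Section Filtration.
Variables (K : fieldType) (n : nat).
Local Notation A := {mpoly K[n.+1]}.
Local Notation v := ('X_(ord0 : 'I_n.+1) : A).
Local Notation y i := ('X_(lift ord0 i) : A).

Definition spread_val (S : {set 'I_n}) (j : 'I_n.+1) : {poly A} :=
  if unlift ord0 j is Some i then (if i \in S then 0 else y i)%:P - 'X
  else v%:P + 'X.

(** Translation of [v] by a new variable [h], the variable of [{poly A}], with the [x_i]
    fixed, followed by the restriction to [y_i = 0] for [i] in [S]. Since [y_i = x_i - v], this is
    [y_i |-> y_i - h] and [v |-> v + h]. *)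
Definition spread S : A -> {poly A} :=
  mmap (polyC \o @mpolyC n.+1 K) (spread_val S).

HB.instance Definition _ S := GRing.RMorphism.on (spread S).

Lemma spreadX S j : spread S 'X_j = spread_val S j.
Proof. by rewrite /spread mmapX mmap1U. Qed.

Lemma spread_shift S (r : {mpoly K[n]}) :
  spread S (shift r) = (kill S (shift r))%:P.
Proof.
apply: (rmorph_mpoly_ext (f := spread S \o @shift K n)
                         (g := polyC \o (kill S \o @shift K n))) => [a|i] /=.
  by rewrite /shift /kill /spread /subst !mmapC.
rewrite shiftX rmorphD /= !spreadX /spread_val liftK unlift_none.
by rewrite !rmorphD /= kill_y kill_v; ring.
Qed.

(** In a monomial with at most [c] zero exponents, more than [e] of the [y_i] with [i] in
    [S] occur, and each of them becomes a multiple of [h]. *)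
Lemma spread_low c e (S : {set 'I_n}) (P : A) :
  vanish_zeros c P -> (c + e < #|S|)%N -> (spread S P)`_e = 0.
Proof.
move=> sP cS; rewrite [P]mpolyE rmorph_sum coef_sum; apply: big1_seq => u /= uP.
have zu : (#|zeros u| <= c)%N.
  by rewrite leqNgt; apply: contraL uP => /(vanish_zeros_coeff sP)/eqP; rewrite mcoeff_eq0.
rewrite -mul_mpolyC rmorphM /= [X in X * _]/spread mmapC /= coefCM.
rewrite /spread mmapX /mmap1 big_ord_recl.
rewrite (bigID (mem (S :\: zeros u))) /=.
rewrite (eq_bigr (fun i => 'X * - (- 'X) ^+ (u (lift ord0 i)).-1)) => [|i]; last first.
  rewrite !inE /spread_val liftK => /andP[ui ->]; rewrite sub0r.
  by case: (u _) ui => // l _; rewrite exprS mulNr mulrN.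
rewrite big_split /= prodr_const mulrCA -!mulrA coefXnM ifT ?mulr0 //.
have lt_e : (e < #|S :\: zeros u|)%N.
  by rewrite cardsD; have := subset_leq_card (subsetIr S (zeros u)); lia.
exact: lt_e.
Qed.

(** In the translate by [h], the coefficient of [h ^ e] is the leading coefficient
    [r e]. *)
Lemma top_coeff c e (r : nat -> {mpoly K[n]}) :
  vanish_zeros c (\sum_(i < e.+1) v ^+ i * shift (r i)) -> vanish_equal (c + e) (r e).
Proof.
move=> sP S cS; have := spread_low sP cS.
rewrite rmorph_sum coef_sum big_ord_recr /= big1 ?add0r => [|i _].
  rewrite rmorphM rmorphXn /= spreadX /spread_val unlift_none spread_shift coefMC.
  rewrite addrC -[v%:P]opprK -rmorphN.
  have := monic_exp e (monicXsubC (- v)); rewrite monicE lead_coefE size_exp_XsubC /=.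
  by move/eqP => ->; rewrite mul1r.
rewrite rmorphM rmorphXn /= spreadX /spread_val unlift_none spread_shift coefMC.
rewrite addrC -[v%:P]opprK -rmorphN nth_default ?mul0r //.
by rewrite size_exp_XsubC.
Qed.

(** The classes of [v ^ e * r], for [r] outside of [J_(c+e)], are independent: the
    relations are removed from the highest power of [v] down, using [top_coeff]. *)
Lemma filtration_free c l (r : nat -> {mpoly K[n]}) :
    (forall e, vanish_equal (c + e) (r e) -> r e = 0) ->
    vanish_zeros c (\sum_(i < l) v ^+ i * shift (r i)) ->
  forall e, (e < l)%N -> r e = 0.
Proof.
move=> r0; elim: l => // l IH sP e; have rl := r0 l (top_coeff sP).
rewrite ltnS leq_eqVlt => /orP[/eqP -> //|]; apply: IH.
by move: sP; rewrite big_ord_recr /= rl rmorph0 mulr0 addr0.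
Qed.

End Filtration.

Section Spanning.
Variables (K : fieldType) (n c k : nat).
Hypothesis n_le : (n <= 2 * c + 1)%N.
Local Notation A := {mpoly K[n.+1]}.
Local Notation v := ('X_(ord0 : 'I_n.+1) : A).
Local Notation y i := ('X_(lift ord0 i) : A).
Variable W : A -> Prop.
Hypotheses (subW : subspace W) (starW : forall P, vanish_zeros c P -> W P).

(** The columns have length 1 or 2 when there are at most [n] of them, and counting
    indices leaves at least [e] singletons, by [n <= 2c + 1]. With more than [n] columns all indices
    are singletons; then [n - c < e] of them will do. *)
Lemma balanced_singletons e (kap : 'I_n -> 'I_(c + e)) : (0 < e)%N -> balanced kap ->
  exists s : seq 'I_n, [/\ uniq s, size s = minn e (n - c) &
    forall i j, i \in s -> kap j = kap i -> j = i].
Proof.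
move=> e_gt0 bal; pose Sg := [set i | class_size kap (kap i) == 1%N].
have SgP i j : i \in Sg -> kap j = kap i -> j = i.
  rewrite inE => /cards1P[x /setP xE] kji.
  have := xE j; have := xE i; rewrite !inE kji eqxx.
  by move=> /esym/eqP -> /esym/eqP ->.
suff le : (minn e (n - c) <= #|Sg|)%N.
  have [s [us ss sS]] := card_geqP le.
  by exists s; split=> // i j /sS; exact: SgP.
have [nc|nc] := leqP (c + e) n.
  have c1 a : (1 <= class_size kap a <= 2)%N.
    by rewrite (balanced_gt0 nc bal) (balanced_le2 _ bal) //; lia.
  have : (\sum_(a : 'I_(c + e)) 2 <=
          \sum_a (class_size kap a + (class_size kap a == 1) * class_size kap a))%N.
    by apply: leq_sum => a _; case: (class_size kap a =P 1%N) (c1 a) => /=; lia.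
  rewrite big_split /= class_size_sum sum_nat_const card_ord.
  suff -> : (\sum_a (class_size kap a == 1) * class_size kap a = #|Sg|)%N.
    by move=> H; set X := #|Sg| in H *; lia.
  rewrite /Sg -sum1dep_card (partition_big kap xpredT) //=.
  apply: eq_bigr => a _; rewrite [RHS]big_mkcondl /=.
  rewrite [X in (_ * X)%N](_ : _ = \sum_(i | kap i == a) 1)%N; last first.
    by rewrite /class_size -sum1dep_card.
  by rewrite big_distrr; apply: eq_bigr => i /eqP -> /=; case: (_ == 1%N).
suff -> : Sg = setT by rewrite cardsT card_ord; lia.
have [a a0] : exists a, (class_size kap a < 1)%N.
  apply/existsP; apply: contraT; rewrite negb_exists => /forallP H.
  have : (\sum_(a < c + e) 1 <= \sum_a class_size kap a)%N.
    by apply: leq_sum => b _; have := H b; rewrite -ltnNge.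
  by rewrite class_size_sum sum_nat_const card_ord; lia.
apply/setP => i; rewrite !inE eqn_leq; apply/andP; split.
  by have := bal (kap i) a; lia.
by rewrite card_gt0; apply/set0Pn; exists i; rewrite inE.
Qed.

(** More than [c] indices outside of [s] form, together with [s], more than [c + e]
    indices, or more than [n]. So two of them share a column, and these two are not in [s]. *)
Lemma singletons_vanish_zeros e (kap : 'I_n -> 'I_(c + e)) (s : seq 'I_n) :
    uniq s -> size s = minn e (n - c) ->
    (forall i j, i \in s -> kap j = kap i -> j = i) ->
  vanish_zeros c (shift (colprod K kap) * \prod_(i <- s) y i).
Proof.
move=> us ss single S cS; rewrite rmorphM rmorph_prod /=.
case: (boolP (has (mem S) s)) => [/hasP[i iS /= iSS]|/hasPn sS].
  rewrite (bigD1_seq i) //= kill_y iSS mul0r mulr0 //.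
have dis : #|S :|: [set i in s]| = (#|S| + size s)%N.
  rewrite cardsU cardsE (card_uniqP us) (_ : _ :&: _ = set0) ?cards0 ?subn0 //.
  apply/setP => i; rewrite !inE; apply/negbTE; rewrite negb_and orbC -implybE.
  by apply/implyP => /sS.
(* If [size s] is [n - c] instead of [e], the union has more than [n] elements. *)
have : (c + e < #|S :|: [set i in s]|)%N.
  rewrite dis ss; have [le|le] := leqP e (n - c); first by lia.
  have : (#|S :|: [set i in s]| <= n)%N by rewrite -[leqRHS]card_ord max_card.
  by rewrite dis ss; lia.
rewrite -{1}[(c + e)%N]card_ord => /(@pigeonhole _ _ kap)[a [b [aU bU ab kab]]].
have inS x z : x \in S :|: [set i in s] -> x != z -> kap x = kap z -> x \in S.
  rewrite !inE => /orP[//|xs] xz kxz.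
  by rewrite (single x z xs (esym kxz)) eqxx in xz.
rewrite (@kill_colprod _ _ _ kap S a b) ?mul0r //; first exact: (inS _ b).
by apply: (inS _ a) => //; rewrite eq_sym.
Qed.

(** Expansion of [\prod (x_i - v)] in powers of [v]: only the top one is not yet known to
    be in [W]. *)
Lemma prod_y_lead e (s : seq 'I_n) i l (r : {mpoly K[n]}) :
    (forall e' r', (e' < e)%N -> (e' <= k)%N -> r' \is (k - e').-homog ->
       W (v ^+ e' * shift r')) ->
    (i + size s <= e)%N -> r \is l.-homog -> (i + size s + l = k)%N ->
  W (v ^+ i * shift r * \prod_(x <- s) y x -
     (-1) ^+ size s *: (v ^+ (i + size s) * shift r)).
Proof.
move=> IHe; elim: s i l r => [|x s IH] i l r /= ie hr ik.
  by rewrite big_nil mulr1 addn0 expr0 scale1r subrr; case: subW.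
rewrite big_cons.
have yE : y x = shift 'X_x - v by rewrite shiftX addrK.
have h1 : (r * 'X_x) \is (l + 1).-homog by rewrite dhomogM ?dhomogX /= ?mdeg1.
have W1 : W (v ^+ (i + size s) * shift (r * 'X_x)).
  apply: IHe; [lia | lia |].
  by rewrite (_ : (k - (i + size s))%N = (l + 1)%N) //; lia.
have W2 : W (v ^+ i * shift (r * 'X_x) * \prod_(x <- s) y x).
  rewrite -[X in W X](subrK ((-1) ^+ size s *: (v ^+ (i + size s) * shift (r * 'X_x)))).
  apply: (subspaceD subW); last exact: (subspaceZ subW).
  by apply: (IH _ (l + 1)%N) => //; lia.
have W3 := IH i.+1 l r _ hr _.
have {}W3 : W (v ^+ i.+1 * shift r * \prod_(x <- s) y x -
     (-1) ^+ size s *: (v ^+ (i.+1 + size s) * shift r)) by apply: W3; lia.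
have := subspaceB subW W2 W3; congr (W _).
rewrite rmorphM /= yE addSnnS [(-1) ^+ (size s).+1]exprS mulN1r scaleNr [v ^+ i.+1]exprS.
by move: (_ *: _) => Z; ring.
Qed.

(** Supplied by a basis of the quotient by [J_(c+e)] whose multiples by [v ^ e] are in
    [W]. *)
Hypothesis W_vanish_equal : forall e (r : {mpoly K[n]}),
  (e <= k)%N -> r \is (k - e).-homog ->
  exists q, [/\ q \is (k - e).-homog, vanish_equal (c + e) q & W (v ^+ e * shift (r - q))].

(** An element of [J_(c+e)] is, modulo [vanish_zeros c], a leading coefficient that
    lower powers of [v] can replace. So the quotients of [K[x]] by the [J_(c+e)] span all layers. *)
Lemma span_layer e (r : {mpoly K[n]}) :
  (e <= k)%N -> r \is (k - e).-homog -> W (v ^+ e * shift r).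
Proof.
elim/ltn_ind: e r => e IH r ek hr; have [q [hq eq Wrq]] := W_vanish_equal ek hr.
suff Wq : W (v ^+ e * shift q).
  by have := subspaceD subW Wrq Wq; rewrite -mulrDr -rmorphD subrK.
have [e0|e_gt0] := posnP e.
  by rewrite e0 mul1r; apply: starW; move: eq; rewrite e0 addn0.
have [l [a [g [Sg qE]]]] :
    ideal_gen (fun f => exists kap : 'I_n -> 'I_(c + e),
                 balanced kap /\ f = colprod K kap) q.
  have IM := @ideal_genM {mpoly K[n]}.
  apply: (vanish_equal_colprod (ideal_gen_subspace _) _ hq eq) => u kap _.
  apply: (IM); apply: colprod_balance => [||kap' bal]; [exact: IM | exact: ideal_genD |].
  by apply: ideal_gen_in; exists kap'.
have -> : q = \sum_(i < l) pihomog mdeg (k - e) (a i * g i).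
  by rewrite -raddf_sum -qE /= pihomog_dE.
rewrite rmorph_sum mulr_sumr; apply: (subspace_bigsum subW) => i _.
have [kap [bal gE]] := Sg i; rewrite {}gE.
have hF := colprod_homog K kap.
have := pihomogP mdeg (k - e) (a i * colprod K kap).
have [g' ->] := pihomog_mull (k - e) (a i) hF => hg'.
have [s [us ss single]] := balanced_singletons e_gt0 bal.
have se : (size s <= e)%N by rewrite ss geq_minl.
have Wstar : W (v ^+ (e - size s) * shift (g' * colprod K kap) * \prod_(x <- s) y x).
  apply: starW; rewrite rmorphM mulrA -mulrA; apply: vanish_zerosM.
  exact: singletons_vanish_zeros single.
have := prod_y_lead (e := e) (s := s) (i := e - size s) (l := k - e) _ _ hg' _.
rewrite subnK // => /(_ _ _ _)/(subspaceB subW Wstar) W'.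
have {W'} : W ((-1) ^+ size s *: (v ^+ e * shift (g' * colprod K kap))).
  by rewrite -[X in W X](subKr (v ^+ (e - size s) * shift (g' * colprod K kap) *
       \prod_(x <- s) y x)); apply: W' => //; [move=> e' r' *; exact: IH | lia].
by move/(subspaceZ subW ((-1) ^+ size s)); rewrite scalerA -expr2 sqrr_sign scale1r.
Qed.

(** Substituting [y_i = x_i - v] one factor at a time rewrites a monomial in [y] and [v] in
    terms of [x] and [v]. *)
Lemma span_monomial d (m : 'X_{1..n.+1}) e l (r : {mpoly K[n]}) :
  mdeg m = d -> (e + l + d = k)%N -> r \is l.-homog -> W (v ^+ e * shift r * 'X_[m]).
Proof.
elim: d m e l r => [|d IH] m e l r md elk hr.
  move/eqP: md; rewrite mdeg_eq0 => /eqP ->; rewrite mpolyX0 mulr1.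
  by apply: span_layer; [lia | rewrite (_ : (k - e)%N = l) //; lia].
have [j mj] : exists j, m j != 0%N.
  apply/existsP; apply: contraT; rewrite negb_exists => /forallP m0.
  move: md; rewrite mdegE big1 // => j _; by apply/eqP; have := m0 j; rewrite negbK.
have jm : (U_(j) <= m)%MM.
  by apply/mnm_lepP => i; rewrite mnm1E; case: eqP => // <-; rewrite lt0n.
rewrite -(submK jm) mpolyXD; set m' := (m - U_(j))%MM.
have md' : mdeg m' = d.
  by have := congr1 (@mdeg _) (submK jm); rewrite mdegD mdeg1 md addn1 => -[].
have Wv : W (v ^+ e.+1 * shift r * 'X_[m']) by apply: (IH _ _ l) => //; lia.
have [->|[i ->]] : j = ord0 \/ exists i, j = lift ord0 i.
- by case: (unliftP ord0 j) => [i ->|->]; [right; exists i | left].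
- by move: Wv; congr (W _); rewrite exprS; ring.
have Wx : W (v ^+ e * shift (r * 'X_i) * 'X_[m']).
  by apply: (IH _ _ (l + 1)%N) => //; [lia | rewrite dhomogM ?dhomogX /= ?mdeg1].
have := subspaceB subW Wx Wv; congr (W _).
by rewrite rmorphM /= shiftX exprS; ring.
Qed.

Lemma span_all p : p \is k.-homog -> W p.
Proof.
move=> /dhomogP hp; rewrite [p]mpolyE big_seq.
apply: (subspace_bigsum subW) => m /hp mk; apply: (subspaceZ subW).
have := @span_monomial k m 0 0 1 mk; rewrite rmorph1 !mul1r.
by apply=> //; exact: dhomog1.
Qed.

End Spanning.

Lemma subst_homog (K : fieldType) n m l (h : 'I_n -> {mpoly K[m]}) p :
  (forall i, h i \is 1.-homog) -> p \is l.-homog -> subst h p \is l.-homog.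
Proof.
move=> h1 /dhomogP hp; rewrite substE big_seq rpred_sum // => u /hp <-.
rewrite rpredZ //= mdegE; apply: (big_rec2 (fun (q : {mpoly K[m]}) d => q \is d.-homog)).
  exact: dhomog1.
move=> i d q _ hq; apply: dhomogM => //.
by have := dhomogMn (u i) (h1 i); rewrite mul1n.
Qed.

Section HilbertSum.
Variables (K : fieldType) (n c k : nat).
Hypothesis n_le : (n <= 2 * c + 1)%N.
Local Notation A := {mpoly K[n.+1]}.
Local Notation v := ('X_(ord0 : 'I_n.+1) : A).

Let H e := hilbert_fun (@vanish_equal K n (c + e)) (k - e).

(** The basis consists of the [v ^ e * b], for [b] in a basis of the degree [k - e] part
    of the quotient by [J_(c+e)]. *)
Lemma vanish_zeros_dim_sum : quot_dim (@vanish_zeros K n c) k (\sum_(e < k.+1) H e).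
Proof.
pose basis e := proj1_sig (constructive_indefinite_description _
  (quot_dim_hilbert (k - e) (vanish_equal_subspace K n (c + e)))).
have basisP e : quot_basis (@vanish_equal K n (c + e)) (k - e) (basis e).
  by rewrite /basis; case: constructive_indefinite_description.
pose T : finType := {e : 'I_k.+1 & 'I_(H e)}.
pose tg (e : 'I_k.+1) (j : 'I_(H e)) : T := Tagged (fun e : 'I_k.+1 => 'I_(H e)) j.
pose G (t : T) : A := v ^+ tag t * shift (basis (tag t) (tagged t)).
have -> : (\sum_(e < k.+1) H e)%N = #|T|.
  rewrite -sum1_card -(sig_big_dep (fun _ => true) (fun _ _ => true) (fun _ _ => 1%N)).
  by apply: eq_bigr => e _; rewrite sum1_card card_ord.
have layer (e : 'I_k.+1) (a : 'I_(H e) -> K) :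
    \sum_j a j *: G (tg e j) = v ^+ e * shift (\sum_j a j *: basis e j).
  rewrite rmorph_sum mulr_sumr; apply: eq_bigr => j _.
  by rewrite /= shiftZ -scalerAr.
have sumG (a : T -> K) : \sum_t a t *: G t =
    \sum_(e < k.+1) v ^+ e * shift (\sum_j a (tg e j) *: basis e j).
  transitivity (\sum_(e < k.+1) \sum_j a (tg e j) *: G (tg e j)).
    rewrite (sig_big_dep (fun _ => true) (fun _ _ => true)
      (fun e j => a (tg e j) *: G (tg e j))) /=.
    by apply: eq_bigr => -[e j].
  by apply: eq_bigr => e _; rewrite layer.
apply: (quot_dim_fin (b := G)).
- move=> [e j]; rewrite /G /=; have ek : (e <= k)%N by rewrite -ltnS.
  suff : v ^+ e * shift (basis e j) \is (e + (k - e)).-homog by rewrite subnKC.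
  apply: dhomogM.
    have hv : v \is 1.-homog by rewrite dhomogX /= mdeg1.
    by have := dhomogMn e hv; rewrite mul1n.
  apply: subst_homog; last by case: (basisP e).
  by move=> i; rewrite dhomogD ?dhomogX /= ?mdeg1.
- move=> a; rewrite sumG => sa.
  (* The zero default makes [r] a sequence indexed by all of [nat]. *)
  pose r e := if insub e is Some e' then \sum_j a (tg e' j) *: basis e' j else 0.
  have rE (e : 'I_k.+1) : r e = \sum_j a (tg e j) *: basis e j by rewrite /r valK.
  have r0 e : vanish_equal (c + e) (r e) -> r e = 0.
    rewrite /r; case: insubP => // e' _ <-; case: (basisP e') => _ fb _ /fb a0.
    by apply: big1 => j _; rewrite a0 scale0r.
  have {}sa : vanish_zeros c (\sum_(e < k.+1) v ^+ e * shift (r e)).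
    by congr (vanish_zeros c _): sa; apply: eq_bigr => e _; rewrite rE.
  move=> [e j]; have := filtration_free r0 sa (ltn_ord e); rewrite rE => re0.
  case: (basisP e) => _ /(_ (fun j => a (tg e j))) fb _; apply: fb.
  by rewrite re0; case: (vanish_equal_subspace K n (c + e)).
pose W (q : A) := exists a : T -> K, vanish_zeros c (q - \sum_t a t *: G t).
have star_sub := vanish_zeros_subspace K n c.
have subW : subspace W.
  split=> [|a p q [ap sp] [aq sq]].
    exists (fun=> 0); rewrite big1 ?subr0; first by case: star_sub.
    by move=> t _; rewrite scale0r.
  exists (fun t => a * ap t + aq t).
  have := star_sub.2 a _ _ sp sq; congr (vanish_zeros c _).
  rewrite scalerBr addrACA -opprD; congr (_ - _); rewrite scaler_sumr -big_split /=.
  by apply: eq_bigr => t _; rewrite scalerDl scalerA.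
have starW P : vanish_zeros c P -> W P.
  by exists (fun=> 0); rewrite big1 ?subr0 // => t _; rewrite scale0r.
have WG t : W (G t).
  exists (fun t' => (t' == t)%:R); rewrite (bigD1 t) //= eqxx scale1r big1.
    by rewrite addr0 subrr; case: star_sub.
  by move=> t' /negbTE ->; rewrite scale0r.
apply: (span_all n_le subW starW) => e r ek hr.
have [hb _ /(_ r hr)[a ea]] := basisP e.
exists (r - \sum_j a j *: basis e j); split=> //.
  by rewrite rpredB // rpred_sum // => j _; rewrite rpredZ ?hb.
rewrite subKr; have ek' : (e < k.+1)%N by [].
rewrite -[e]/(nat_of_ord (Ordinal ek')) in a ea *.
by rewrite -layer; apply: (subspace_bigsum subW) => j _; apply: (subspaceZ subW).
Qed.

End HilbertSum.

(** * Counting monomials by support *)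

(** The exponents of [y_0, ..., y_(n-1)] in the monomials of degree [k] with exactly [s] of
    these exponents nonzero; the exponent of [v] is what remains of the degree. *)
Fixpoint exps (n k s : nat) : seq (seq nat) :=
  if n is n'.+1 then
    map (cons 0%N) (exps n' k s) ++
    (if s is s'.+1 then
       [seq a.+1 :: w | a <- iota 0 k, w <- exps n' (k - a.+1) s'] else [::])
  else if s == 0%N then [:: [::]] else [::].

Lemma mem_exps n k s w :
  (w \in exps n k s) = [&& size w == n, sumn w <= k & count (leq 1) w == s]%N.
Proof.
elim: n k s w => [|n IH] k s w /=.
  by case: s => [|s]; case: w => [|a w]; rewrite ?inE ?andbF.
rewrite mem_cat; case: w => [|a w] /=.
  apply/negbTE; rewrite negb_or; apply/andP; split; first by apply/mapP => -[].
  by case: s => // s; apply/allpairsPdep => -[? [? []]].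
case: a => [|a].
  rewrite mem_map ?IH /= => [|? ? []] //; rewrite eqSS add0n.
  rewrite [X in _ || X](_ : _ = false) ?orbF ?add0n //; apply/negbTE.
  by case: s => // s; apply/allpairsPdep => -[? [? []]].
rewrite [X in X || _](_ : _ = false) /=; last by apply/mapP => -[].
case: s => [|s]; first by rewrite add1n andbF andbF.
apply/allpairsPdep/idP => [[a' [w' [ak]]]|].
  rewrite mem_iota IH in ak *.
  by case/and3P=> /eqP <- sk /eqP <- [-> ->]; rewrite !eqxx /= andbT; move: ak sk; lia.
rewrite !eqSS => /and3P[/eqP sw sk /eqP sc]; exists a, w; split=> //.
  by rewrite mem_iota; move: sk; lia.
by rewrite IH sw eqxx /=; apply/andP; split; [|apply/eqP]; lia.
Qed.

Lemma uniq_exps n k s : uniq (exps n k s).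
Proof.
elim: n k s => [|n IH] k s /=; first by case: s.
rewrite cat_uniq map_inj_uniq ?IH => [|? ? []] //=; apply/andP; split.
  apply/hasPn => w ws; apply/mapP => -[w' _ wE]; move: ws; rewrite wE.
  by case: s => // s /allpairsPdep[? [? []]].
case: s => // s; apply: allpairs_uniq_dep; [exact: iota_uniq | by move=> *; exact: IH |].
by move=> [a w] [a' w'] _ _ /= [-> ->].
Qed.

Lemma sum_bin_diag k s : (\sum_(i < k) 'C(i, s) = 'C(k, s.+1))%N.
Proof. by elim: k => [|k IH]; rewrite ?big_ord0 ?big_ord_recr //= IH binS. Qed.

(** A support of size [s] and the [s] distinct partial sums, in [1, ..., k], of the exponents
    determine the monomial. The proof follows the recursion of [exps]. *)
Lemma size_exps n k s : size (exps n k s) = ('C(n, s) * 'C(k, s))%N.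
Proof.
elim: n k s => [|n IH] k s /=; first by case: s => [|s]; rewrite /= ?bin0 ?bin0n.
rewrite size_cat size_map IH; case: s => [|s]; first by rewrite /= !bin0 ?addn0.
rewrite size_allpairs_dep sumnE big_map binS mulnDl; congr (_ + _)%N.
rewrite -sum_bin_diag big_distrr /=.
rewrite -[in RHS](big_mkord xpredT (fun i => 'C(n, s) * 'C(i, s))%N) big_nat_rev /=.
rewrite /index_iota subn0; apply: eq_big_seq => a; rewrite mem_iota add0n => /andP[_ ak].
by rewrite IH ?add0n.
Qed.

Definition zeros_monomials n c k : pred 'X_{1..n.+1 < k.+1} :=
  [pred m : 'X_{1..n.+1 < k.+1} | (mdeg m == k) && (c < #|zeros m|)%N].

Arguments zeros_monomials : clear implicits.

Lemma vanish_zeros_dim_monomials (K : fieldType) n c k :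
  quot_dim (@vanish_zeros K n c) k #|zeros_monomials n c k|.
Proof.
rewrite -[#|_|]card_ord.
pose u (i : 'I_#|zeros_monomials n c k|) : 'X_{1..n.+1} := val (enum_val i).
have uP i : (mdeg (u i) == k) && (c < #|zeros (u i)|)%N by have := enum_valP i.
apply: (quot_dim_fin (b := fun i => 'X_[u i])).
- by move=> i; rewrite dhomogX /=; case/andP: (uP i).
- move=> a sa i; have := vanish_zeros_coeff sa (proj2 (andP (uP i))).
  rewrite raddf_sum /= (bigD1 i) //= mcoeffZ mcoeffX eqxx mulr1 big1 ?addr0 //.
  move=> j /negbTE ne; rewrite mcoeffZ mcoeffX /u (inj_eq val_inj).
  by rewrite (inj_eq enum_val_inj) ne mulr0.
move=> p hp; exists (fun i => p@_(u i)).
have sub := vanish_zeros_subspace K n c.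
rewrite {1}(mpolywE (k := k.+1) (p := p)); last first.
  have [->|nz] := eqVneq p 0; first by rewrite msize0.
  by rewrite -mlead_deg //; move/dhomogP: hp => /(_ _ (mlead_supp nz)) /= ->.
rewrite (bigID (mem (zeros_monomials n c k))) /=.
rewrite (big_enum_val (fun m : 'X_{1..n.+1 < k.+1} => p@_m *: 'X_[m])).
rewrite [X in X - _]addrC addrK.
apply: (subspace_bigsum sub) => m.
rewrite inE negb_and => /orP[mk|zc].
  by rewrite (dhomog_nemf_coeff hp mk) scale0r; case: sub.
by apply: (subspaceZ sub); apply: vanish_zerosX; rewrite leqNgt.
Qed.

Lemma card_monomials n c k :
  #|zeros_monomials n c k| =
  (\sum_(s < n - c) 'C(n, s) * 'C(k, s))%N.
Proof.
pose w (m : 'X_{1..n.+1 < k.+1}) := [seq m (lift ord0 i) | i <- enum 'I_n].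
have sum_w m : (sumn (w m) + m ord0 = mdeg m)%N.
  by rewrite mdegE big_ord_recl addnC sumnE big_map big_enum.
have supp_w m : (count (leq 1) (w m) + #|zeros m| = n)%N.
  rewrite count_map -sum1_count big_enum_cond /= sum1dep_card.
  rewrite -[RHS]card_ord -(cardsC (zeros m)) addnC; congr (_ + _)%N.
  by apply: eq_card => i; rewrite !inE lt0n.
pose P s := [pred m : 'X_{1..n.+1 < k.+1} | (mdeg m == k) && (count (leq 1) (w m) == s)].
have card_P s : #|P s| = ('C(n, s) * 'C(k, s))%N.
  rewrite -size_exps cardE -(size_map w); apply: perm_size; apply: uniq_perm.
  - rewrite map_inj_in_uniq ?enum_uniq // => m m'; rewrite !mem_enum !inE.
    move=> /andP[/eqP mk _] /andP[/eqP m'k _] ww; apply/val_inj/mnmP => j.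
    have eq_y i : m (lift ord0 i) = m' (lift ord0 i).
      by have /eq_in_map/(_ i) := ww; rewrite mem_enum; apply.
    case: (unliftP ord0 j) => [i ->|->]; first exact: eq_y.
    have := etrans (sum_w m) (etrans mk (etrans (esym m'k) (esym (sum_w m')))).
    by rewrite ww => /addnI.
  - exact: uniq_exps.
  move=> x; rewrite mem_exps; apply/mapP/and3P => [[m]|[/eqP sx xk xs]].
    rewrite mem_enum inE => /andP[/eqP mk ms] ->.
    by rewrite size_map size_enum_ord -mk -(sum_w m) leq_addr.
  (* Index 0 is that of [v], which takes up the rest of the degree. *)
  pose m0 := [multinom (if unlift ord0 j is Some i then nth 0%N x i else k - sumn x)%N | j < n.+1].
  have wx : [seq m0 (lift ord0 i) | i <- enum 'I_n] = x.
    apply: (@eq_from_nth _ 0%N); first by rewrite size_map size_enum_ord sx.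
    move=> i; rewrite size_map size_enum_ord => lt_i.
    by rewrite (nth_map (Ordinal lt_i)) ?size_enum_ord // mnmE liftK nth_enum_ord.
  have m0k : mdeg m0 = k.
    rewrite mdegE big_ord_recl mnmE unlift_none -{2}(subnK xk); congr (_ + _)%N.
    by rewrite -[in RHS]wx sumnE big_map big_enum.
  have lt_m0 : (mdeg m0 < k.+1)%N by rewrite m0k.
  by exists (BMultinom lt_m0); rewrite ?mem_enum ?inE /= ?m0k ?eqxx /w /= wx.
rewrite (eq_bigr (fun s : 'I_(n - c) => #|P s|)) => [|s _]; last by rewrite card_P.
rewrite -sum1_card.
have supp_lt (m : 'X_{1..n.+1 < k.+1}) : (c < #|zeros m|)%N = (count (leq 1) (w m) < n - c)%N.
  by have := supp_w m; lia.
have [nc|nc] := posnP (n - c).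
  rewrite nc big_ord0 big_pred0 // => m; rewrite inE supp_lt nc andbF //.
pose f (m : 'X_{1..n.+1 < k.+1}) : 'I_(n - c) := insubd (Ordinal nc) (count (leq 1) (w m)).
rewrite (partition_big f xpredT) //=; apply: eq_bigr => s _.
rewrite -sum1_card; apply: eq_bigl => m; rewrite !inE supp_lt -andbA; congr (_ && _).
rewrite -val_eqE /f val_insubd; case: ltnP => //= le.
by rewrite gtn_eqF // (leq_trans (ltn_ord s)).
Qed.

Lemma vanish_zeros_dim (K : fieldType) n c k :
  quot_dim (@vanish_zeros K n c) k (\sum_(s < n - c) 'C(n, s) * 'C(k, s)).
Proof. by rewrite -card_monomials; exact: vanish_zeros_dim_monomials. Qed.

Lemma hilbert_vanish_equal_sum (K : fieldType) n c k : (n <= 2 * c + 1)%N ->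
  (\sum_(e < k.+1) hilbert_fun (@vanish_equal K n (c + e)) (k - e) =
   \sum_(s < n - c) 'C(n, s) * 'C(k, s))%N.
Proof.
move=> n_le; apply: (quot_dim_uniq (vanish_zeros_subspace K n c)).
  exact: vanish_zeros_dim_sum n_le.
exact: vanish_zeros_dim.
Qed.

(** The sum in [hilbert_vanish_equal_sum] for [c] is the term [e = 0] plus the sum for
    [c + 1] in degree [k - 1]. *)
Lemma hilbert_vanish_equal (K : fieldType) n c k : (n <= 2 * c + 1)%N ->
  (hilbert_fun (@vanish_equal K n c) k + (if k is k'.+1 then
     \sum_(s < n - c.+1) 'C(n, s) * 'C(k', s) else 0) =
   \sum_(s < n - c) 'C(n, s) * 'C(k, s))%N.
Proof.
move=> n_le; rewrite -(hilbert_vanish_equal_sum K k n_le) big_ord_recl addn0 subn0.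
congr (_ + _)%N; case: k => [|k]; first by rewrite big_ord0.
rewrite -(@hilbert_vanish_equal_sum K); last by lia.
by apply: eq_bigr => e _; rewrite lift0 addSnnS subSS.
Qed.

(** * The numerator of the Hilbert series *)

Section Series.
Implicit Types (F G : nat -> int) (P Q R : {poly int}).

(** [series_eq_frac] for functions with values in [int], which can be subtracted. *)
Definition int_series F P Q : Prop := forall k, \sum_(j < k.+1) F j * Q`_(k - j) = P`_k.

(** Multiplication of a power series by its variable. *)
Definition delay F : nat -> int := fun k => if k is k'.+1 then F k' else 0.

Lemma int_series_eq F G P Q : F =1 G -> int_series F P Q -> int_series G P Q.
Proof. by move=> FG H k; rewrite -H; apply: eq_bigr => j _; rewrite FG. Qed.

Lemma int_seriesB F G P Q R :
  int_series F P R -> int_series G Q R ->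
  int_series (fun j => F j - G j) (P - Q) R.
Proof.
move=> HF HG k; rewrite coefB -HF -HG -sumrB.
by apply: eq_bigr => j _; rewrite mulrBl.
Qed.

Lemma int_series_sum (l : nat) (a : nat -> int) (F : nat -> nat -> int) (P : nat -> {poly int}) Q :
  (forall s, (s < l)%N -> int_series (F s) (P s) Q) ->
  int_series (fun j => \sum_(s < l) a s * F s j) (\sum_(s < l) a s *: P s) Q.
Proof.
move=> H k; rewrite coef_sum; under eq_bigr => j _ do rewrite mulr_suml.
rewrite exchange_big /=; apply: eq_bigr => s _; rewrite coefZ -H //.
by rewrite mulr_sumr; apply: eq_bigr => j _; rewrite mulrA.
Qed.

(** Only the truncation of the power series to degree [k] matters in degree [k], and it is
    a polynomial. *)
Lemma int_series_mulr F P Q R : int_series F P Q -> int_series F (P * R) (Q * R).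
Proof.
move=> H k; pose T := \poly_(j < k.+1) F j.
have TE (U : {poly int}) i : (i <= k)%N -> (T * U)`_i = \sum_(j < i.+1) F j * U`_(i - j).
  move=> ik; rewrite coefM; apply: eq_bigr => j _; rewrite coef_poly ifT //.
  by rewrite (leq_trans (ltn_ord j)).
rewrite -TE // mulrA coefM [RHS]coefM; apply: eq_bigr => i _.
by rewrite TE ?H // -ltnS.
Qed.

Lemma int_series_delay F P Q : int_series F P Q -> int_series (delay F) ('X * P) Q.
Proof.
move=> H [|k]; rewrite big_ord_recl mul0r add0r coefXM; first by rewrite big_ord0.
by rewrite -H; apply: eq_bigr => j _; rewrite lift0 subSS.
Qed.

Lemma int_series_antidiff F P Q :
  int_series (fun j => F j - delay F j) P Q -> int_series F P (Q * (1 - 'X)).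
Proof.
move=> H k; rewrite -H mulrBr mulr1.
under eq_bigr => j _ do rewrite coefB coefMX mulrBr.
under [RHS]eq_bigr => j _ do rewrite mulrBl.
rewrite !sumrB; congr (_ - _); rewrite big_ord_recr big_ord_recl /= subnn mulr0 addr0.
rewrite mul0r add0r; apply: eq_bigr => j _.
rewrite add0n /bump /= ifF; last by rewrite subn_eq0 leqNgt ltn_ord.
by congr (_ * Q`_ _); have := ltn_ord j; lia.
Qed.

Lemma int_series_bin s : int_series (fun j => 'C(j, s)%:Z) 'X^s ((1 - 'X) ^+ s.+1).
Proof.
elim: s => [|s IH].
  rewrite expr1 -[1 - 'X]mul1r; apply: int_series_antidiff => k.
  rewrite big_ord_recl subn0 /= bin0 subr0 mul1r big1 ?addr0 ?expr0 // => j _.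
  by rewrite /= !bin0 subrr mul0r.
rewrite [(1 - 'X) ^+ _]exprSr; apply: int_series_antidiff; rewrite exprS.
apply: int_series_eq (int_series_delay IH) => -[|j] /=; first by rewrite bin0n.
by rewrite binS PoszD [RHS]addrC addKr.
Qed.

(** The numerator over [(1 - X) ^ D] of the generating function of
    [k |-> \sum_(s < D) 'C(n, s) * 'C(k, s)]. The default [0.-1 = 0] is harmless, since the sum is
    then empty. *)
Definition binser (n D : nat) : {poly int} :=
  \sum_(s < D) 'C(n, s)%:Z *: ('X^s * (1 - 'X) ^+ (D.-1 - s)).

Lemma int_series_binser n D :
  int_series (fun j => \sum_(s < D) 'C(n, s)%:Z * 'C(j, s)%:Z) (binser n D) ((1 - 'X) ^+ D).
Proof.
apply: (@int_series_sum D (fun s => 'C(n, s)%:Z) (fun s j => 'C(j, s)%:Z)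
          (fun s => 'X^s * (1 - 'X) ^+ (D.-1 - s))) => s sD.
have -> : D = (s.+1 + (D.-1 - s))%N by lia.
rewrite exprD (_ : (_ .-1 - s)%N = (D.-1 - s)%N); last by lia.
exact: int_series_mulr (int_series_bin s).
Qed.

Lemma binserS n D : binser n.+1 D.+1 = binser n D.+1 + 'X * binser n D.
Proof.
rewrite /binser big_ord_recl [X in _ = X + _]big_ord_recl /= !bin0 -addrA; congr (_ + _).
rewrite mulr_sumr -big_split /=; apply: eq_bigr => s _.
rewrite /bump /= add1n binS PoszD scalerDl; congr (_ + _).
rewrite -scalerAr mulrA -exprS; congr (_ *: (_ * _ ^+ _)).
by have := ltn_ord s; lia.
Qed.

Lemma binser_recr n D : binser n D.+1 = binser n D * (1 - 'X) + 'C(n, D)%:Z *: 'X^D.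
Proof.
rewrite /binser big_ord_recr /= subnn expr0 mulr1; congr (_ + _).
rewrite mulr_suml; apply: eq_bigr => s _; rewrite -scalerAl -mulrA -exprSr.
by congr (_ *: (_ * _ ^+ _)); have := ltn_ord s; lia.
Qed.

(** The numerator over [(1 - X) ^ (D + 1)] of the generating function of
    [b_c(k) - b_(c+1)(k - 1)], for [n - c = D + 1]. *)
Definition filtration_numer (n D : nat) : {poly int} :=
  binser n D.+1 - 'X * (binser n D * (1 - 'X)).

(** The last coefficient [h_(D+1)]. It is zero for [D = 0], where the binomial coefficient
    has a negative lower index. *)
Definition top_coef (c D : nat) : nat := if D is D'.+1 then 'C(c + D, D') else 0.

Definition h_numer (c D : nat) : {poly int} :=
  1 + \sum_(i < D) 'C(c + i, i.+1)%:Z *: 'X^(i.+1) + (top_coef c D)%:Z *: 'X^(D.+1).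

Lemma filtration_numerS n D :
  filtration_numer n.+1 D.+1 = filtration_numer n D.+1 + 'X * filtration_numer n D.
Proof. by rewrite /filtration_numer !binserS; ring. Qed.

Lemma h_numerS c D : h_numer c.+1 D.+1 = h_numer c D.+1 + 'X * h_numer c.+1 D.
Proof.
rewrite /h_numer.
have -> : \sum_(i < D.+1) 'C(c.+1 + i, i.+1)%:Z *: 'X^(i.+1) =
    \sum_(i < D.+1) 'C(c + i, i.+1)%:Z *: 'X^(i.+1) +
    ('X + \sum_(i < D) 'C(c.+1 + i, i.+1)%:Z *: 'X^(i.+2)) :> {poly int}.
  under eq_bigr => i _ do rewrite addSn binS PoszD scalerDl.
  rewrite big_split /=; congr (_ + _).
  rewrite big_ord_recl /= addn0 bin0 scale1r; congr (_ + _).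
  by apply: eq_bigr => i _; rewrite /bump /= add1n addnS addSn.
have -> : (top_coef c.+1 D.+1 = top_coef c D.+1 + top_coef c.+1 D)%N.
  case: D => [|D] /=; first by rewrite !bin0.
  by rewrite addSn binS addSnnS; congr (_ + 'C(_, _))%N; lia.
have shiftX : \sum_(i < D) 'C(c.+1 + i, i.+1)%:Z *: 'X^(i.+2) =
    'X * \sum_(i < D) 'C(c.+1 + i, i.+1)%:Z *: 'X^(i.+1) :> {poly int}.
  by rewrite mulr_sumr; apply: eq_bigr => i _; rewrite -scalerAr -exprS.
rewrite shiftX PoszD scalerDl !mulrDr mulr1 -scalerAr -exprS.
by move: (_ *: _) (_ *: _) ('X * _) => Z1 Z2 Z3; ring.
Qed.

(** Pascal's rule gives both sides the same recursion in [c] and [D]. For [c = 0] the left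
    side is, up to its last two terms, the expansion of [((1 - X) + X) ^ (D + 1)]. *)
Lemma filtration_numerE c D : filtration_numer (c + D.+1) D = h_numer c D.
Proof.
elim: D c => [|D IHD] c.
  rewrite /filtration_numer /h_numer binser_recr /binser !big_ord0 /= bin0 expr0.
  by rewrite scale1r scale0r; ring.
elim: c => [|c IHc]; last by rewrite addSn filtration_numerS IHc -addSnnS IHD h_numerS.
rewrite /h_numer big1 => [|i _]; last by rewrite add0n bin_small ?scale0r.
rewrite /filtration_numer binser_recr add0n /top_coef add0n.
have binom : binser D.+2 D.+1 * (1 - 'X) ^+ 2 =
    1 - D.+2%:Z *: ('X^(D.+1) * (1 - 'X)) - 'X^(D.+2).
  have := exprDn (1 - 'X) ('X : {poly int}) D.+2; rewrite subrK expr1n.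
  rewrite 2!big_ord_recr /= subnn expr0 mul1r binn mulr1n subSnn expr1.
  rewrite binSn [(1 - 'X) * 'X^_]mulrC -scaler_nat natz => one.
  rewrite [X in _ = X - _ - _]one.
  have cancel (a b e : {poly int}) : a + b + e - b - e = a by ring.
  rewrite cancel.
  rewrite /binser mulr_suml; apply: eq_bigr => s _.
  rewrite -scalerAl -mulrA -exprD -scaler_nat natz [in RHS]mulrC.
  by congr (_ *: (_ * _ ^+ _)); have := ltn_ord s; lia.
have -> : binser D.+2 D.+1 * (1 - 'X) + 'C(D.+2, D.+1)%:Z *: 'X^(D.+1) -
    'X * (binser D.+2 D.+1 * (1 - 'X)) =
    binser D.+2 D.+1 * (1 - 'X) ^+ 2 + 'C(D.+2, D.+1)%:Z *: 'X^(D.+1).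
  by move: (_ *: _) => Z; ring.
have splitS (Y : {poly int}) : D.+2%:Z *: Y = D.+1%:Z *: Y + Y.
  by rewrite -[D.+2]addn1 PoszD scalerDl scale1r.
rewrite binom !binSn mulrBr mulr1 -exprSr scalerBr !splitS.
by move: (_ *: _) (_ *: _) => Z1 Z2; ring.
Qed.

End Series.

Lemma series_vanish_equal (K : fieldType) n c d :
  (0 < d)%N -> n = (c + d)%N -> (n <= 2 * c + 1)%N ->
  series_eq_frac (hilbert_fun (@vanish_equal K n c)) (h_numer c d.-1) ((1 - 'X) ^+ d).
Proof.
case: d => // d _ nE n_le /=; rewrite -filtration_numerE -nE.
have n_c : (n - c = d.+1)%N by lia.
have n_c1 : (n - c.+1 = d)%N by lia.
pose F D k : int := \sum_(s < D) 'C(n, s)%:Z * 'C(k, s)%:Z.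
have F2 : int_series (delay (F d)) ('X * (binser n d * (1 - 'X))) ((1 - 'X) ^+ d.+1).
  by apply: int_series_delay; rewrite exprSr; apply: int_series_mulr; exact: int_series_binser.
suff : int_series (fun k => (hilbert_fun (@vanish_equal K n c) k)%:Z)
    (filtration_numer n d) ((1 - 'X) ^+ d.+1).
  by [].
apply: (int_series_eq (F := fun k => F d.+1 k - delay (F d) k)); last first.
  exact: int_seriesB (int_series_binser n d.+1) F2.
move=> k.
have := hilbert_vanish_equal K k n_le; rewrite n_c n_c1 => /(congr1 Posz).
have natE D j : Posz (\sum_(s < D) 'C(n, s) * 'C(j, s))%N = F D j.
  by rewrite -natz natr_sum; apply: eq_bigr => s _; rewrite natz PoszM.
rewrite PoszD [RHS]natE => <-.
by case: k => [|k] /=; rewrite ?subr0 ?natE ?addrK ?addr0.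
Qed.

Lemma h_numerE (h : nat -> nat) c d :
  (forall i, (i < d)%N -> h i.+1 = 'C(c + i, i.+1)) -> h d.+1 = top_coef c d ->
  1 + \sum_(1 <= i < d.+2) 'X^i *+ h i = h_numer c d.
Proof.
move=> hi hd; rewrite big_add1 /= big_mkord big_ord_recr /= addrA hd.
rewrite /h_numer -scaler_nat natz; congr (_ + _ + _); apply: eq_bigr => i _.
by rewrite hi // -scaler_nat natz.
Qed.

Lemma series_eq_frac_ext (H H' : nat -> nat) P Q : (forall k, H k = H' k) ->
  series_eq_frac H' P Q -> series_eq_frac H P Q.
Proof. by move=> HH S k; rewrite -S; apply: eq_bigr => j _; rewrite HH. Qed.

Theorem theorem2p1 (K : fieldType) (n : nat) (n_gt0 : (0 < n)%N) :
  (forall d : nat, (1 <= d)%N -> (d <= n - d)%N ->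
     series_eq_frac
       (hilbert_fun (specht_ideal K n [:: n - d; d]%N))
       (1 + \sum_(1 <= i < d.+1) 'X^i *+ h_two_rows n d i)
       ((1 - 'X) ^+ d))
  /\
  (forall d : nat, (1 <= d)%N -> n = (2 * d + 1)%N ->
     series_eq_frac
       (hilbert_fun (specht_ideal K n [:: d; d; 1]%N))
       (1 + \sum_(1 <= i < d.+2) 'X^i *+ 'C(d + i - 1, i))
       ((1 - 'X) ^+ d.+1)).
Proof.
split=> d d_gt0 dn.
  apply: (series_eq_frac_ext (fun k => hilbert_two_rows K k d_gt0 dn)).
  case: d d_gt0 dn => // d _ dn; rewrite (@h_numerE _ (n - d.+1)).
  - by apply: (@series_vanish_equal K n (n - d.+1) d.+1) => //; lia.
  - by move=> i id; rewrite /h_two_rows ltnS id addnS subn1.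
  rewrite /h_two_rows ltnn /top_coef; case: d dn => // d dn.
  rewrite (_ : d.+2%:Z - 2 = d%:Z); last by lia.
  by rewrite /=; congr 'C(_, _); lia.
apply: (series_eq_frac_ext (fun k => hilbert_odd K k d_gt0 dn)); rewrite (@h_numerE _ d).
- by apply: (@series_vanish_equal K n d d.+1) => //; lia.
- by move=> i id; rewrite addnS subn1.
rewrite addnS subn1 /top_coef; case: d d_gt0 {dn} => // d _.
by rewrite -bin_sub; [congr 'C(_, _); lia | lia].
Qed.
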